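(* Let $d\ge 1$ be an integer, $\vec{\mu}=(\mu_0,\dots,\mu_{d-1})$ a probability distribution, and $\mathcal{O}_{\vec{\mu}}$ the generalized platypus channel associated with $\vec{\mu}$. Then $$P^{(1)}(\mathcal{O}_{\vec{\mu}})=C^{(1)}(\mathcal{O}_{\vec{\mu}})=P(\mathcal{O}_{\vec{\mu}})=C(\mathcal{O}_{\vec{\mu}})=1,\qquad C_E(\mathcal{O}_{\vec{\mu}})=2.$$
   Context: Logarithms are base 2. Generalized platypus channel: let $A$ and $B$ be $(d+1)$-dimensional Hilbert spaces with computational bases $\{|i\rangle\}_{i=0}^{d}$ and $E$ a $d$-dimensional Hilbert space with basis $\{|j\rangle\}_{j=0}^{d-1}$. Define the isometry $V:A\to B\otimes E$ by $V|0\rangle=\sum_{j=0}^{d-1}\sqrt{\mu_j}\,|j\rangle_B\otimes|j\rangle_E$ and $V|i\rangle=|d\rangle_B\otimes|i-1\rangle_E$ for $i=1,\dots,d$; $\mathcal{O}_{\vec{\mu}}(\rho)=\mathrm{Tr}_E(V\rho V^\dagger)$ and $\mathcal{O}^c_{\vec{\mu}}(\rho)=\mathrm{Tr}_B(V\rho V^\dagger)$. For a channel $\mathcal{N}$ with complementary channel $\mathcal{N}^c$ and $S$ the von Neumann entropy: $I_c(\rho,\mathcal{N})=S(\mathcal{N}(\rho))-S(\mathcal{N}^c(\rho))$; for an ensemble $\{p_i,\rho_i\}$, $I_p(\{p_i,\rho_i\},\mathcal{N})=I_c(\sum_ip_i\rho_i,\mathcal{N})-\sum_ip_iI_c(\rho_i,\mathcal{N})$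 and $\chi(\{p_i,\rho_i\},\mathcal{N})=S(\mathcal{N}(\sum_ip_i\rho_i))-\sum_ip_iS(\mathcal{N}(\rho_i))$. The private information is $P^{(1)}(\mathcal{N})=\max I_p$ and the Holevo capacity is $C^{(1)}(\mathcal{N})=\max\chi$, maxima over ensembles; the private capacity is $P(\mathcal{N})=\lim_n\frac1nP^{(1)}(\mathcal{N}^{\otimes n})$ and the classical capacity is $C(\mathcal{N})=\lim_n\frac1nC^{(1)}(\mathcal{N}^{\otimes n})$. The entanglement-assisted classical capacity is $C_E(\mathcal{N})=\max_\rho[S(\rho)+I_c(\rho,\mathcal{N})]$. *)

(* Defs.v *)
From HB Require Import structures.
From mathcomp Require Import all_boot all_order all_algebra.
From mathcomp Require Import all_classical all_reals.
From mathcomp Require Import ereal topology normedtype sequences exp.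
From mathcomp.real_closed Require Import complex.
Set Implicit Arguments. Unset Strict Implicit. Unset Printing Implicit Defensive.
Import Order.TTheory GRing.Theory Num.Theory.
Local Open Scope ring_scope.
Local Open Scope classical_set_scope.

Section QI.
Variable R : realType.
Local Notation C := (R[i]).

Definition log2 (x : R) : R := ln x / ln 2.

(* an operator on the finite-dimensional Hilbert space with orthonormal basis
   indexed by the finite type I, given by its matrix entries *)
Definition op (I : finType) := I -> I -> C.

Definition mxof (I : finType) (A : op I) : 'M[C]_#|I| :=
  \matrix_(i, j) A (enum_val i) (enum_val j).

(* density matrices: positive semidefinite with unit trace
   (in C = R[i], 0 <= z means z is real and nonnegative) *)
Definition is_state (I : finType) (A : op I) : Prop :=
  (forall v : I -> C, 0 <= \sum_i \sum_j conjc (v i) * A i j * v j) /\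
  \sum_i A i i = 1.

Definition spectrum (I : finType) (A : op I) : seq C :=
  sval (closed_field_poly_normal (char_poly (mxof A))).

Definition vN_entropy (I : finType) (A : op I) : R :=
  \sum_(z <- spectrum A) (if complex.Re z == 0 then 0 else - complex.Re z * log2 (complex.Re z)).

(* A channel is given by a Stinespring isometry V : A -> B (x) E,
   with matrix entries V b e a = <b,e| V |a>. *)
Definition isom (A B E : finType) := B -> E -> A -> C.

(* N(rho) = Tr_E (V rho V^dagger) *)
Definition chan (A B E : finType) (V : isom A B E) (rho : op A) : op B :=
  fun b b' => \sum_e \sum_a \sum_a' V b e a * rho a a' * conjc (V b' e a').

(* N^c(rho) = Tr_B (V rho V^dagger) *)
Definition cchan (A B E : finType) (V : isom A B E) (rho : op A) : op E :=
  fun e e' => \sum_b \sum_a \sum_a' V b e a * rho a a' * conjc (V b e' a').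

Definition Icoh (A B E : finType) (V : isom A B E) (rho : op A) : R :=
  vN_entropy (chan V rho) - vN_entropy (cchan V rho).

Definition is_ensemble (A : finType) (m : nat) (p : 'I_m -> R)
    (rho : 'I_m -> op A) : Prop :=
  (forall i, 0 <= p i) /\ \sum_i p i = 1 /\ (forall i, is_state (rho i)).

Definition avg (A : finType) (m : nat) (p : 'I_m -> R) (rho : 'I_m -> op A)
  : op A := fun a a' => \sum_i real_complex R (p i) * rho i a a'.

Definition Ipriv (A B E : finType) (V : isom A B E) (m : nat)
  (p : 'I_m -> R) (rho : 'I_m -> op A) : R :=
  Icoh V (avg p rho) - \sum_i p i * Icoh V (rho i).

Definition Holevo (A B E : finType) (V : isom A B E) (m : nat)
  (p : 'I_m -> R) (rho : 'I_m -> op A) : R :=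
  vN_entropy (chan V (avg p rho)) - \sum_i p i * vN_entropy (chan V (rho i)).

Definition P1 (A B E : finType) (V : isom A B E) : \bar R :=
  ereal_sup [set x | exists m (p : 'I_m -> R) (rho : 'I_m -> op A),
                       is_ensemble p rho /\ x = (Ipriv V p rho)%:E].

Definition C1 (A B E : finType) (V : isom A B E) : \bar R :=
  ereal_sup [set x | exists m (p : 'I_m -> R) (rho : 'I_m -> op A),
                       is_ensemble p rho /\ x = (Holevo V p rho)%:E].

Definition CE (A B E : finType) (V : isom A B E) : \bar R :=
  ereal_sup [set x | exists rho : op A,
                       is_state rho /\ x = (vN_entropy rho + Icoh V rho)%:E].

(* n-fold tensor power: isometry V^{(x)n} : A^n -> B^n (x) E^n, which is a
   Stinespring isometry of N^{(x)n} (its complement being (N^c)^{(x)n}) *)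
Definition tpow (A B E : finType) (V : isom A B E) (n : nat)
  : isom {ffun 'I_n -> A} {ffun 'I_n -> B} {ffun 'I_n -> E} :=
  fun bs es as_ => \prod_i V (bs i) (es i) (as_ i).

(* the generalized platypus isometry:
   V|0> = sum_j sqrt(mu_j) |j>_B |j>_E,  V|i> = |d>_B |i-1>_E  (1 <= i <= d) *)
Definition platypus (d : nat) (mu : 'I_d -> R) : isom 'I_d.+1 'I_d.+1 'I_d :=
  fun b e a =>
    if (a == 0 :> nat) then (if (b == e :> nat) then real_complex R (Num.sqrt (mu e)) else 0)
    else (if (b == d :> nat) && (e.+1 == a :> nat) then 1 else 0).

End QI.

Arguments tpow {R A B E} V n.
Arguments platypus {R d} mu.
Arguments P1 {R A B E} V.
Arguments C1 {R A B E} V.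
Arguments CE {R A B E} V.

(* Main.v *)
Require Import Defs.
From HB Require Import structures.
From mathcomp Require Import all_boot all_order all_algebra.
From mathcomp Require Import all_classical all_reals.
From mathcomp Require Import ereal topology normedtype sequences exp.
From mathcomp.real_closed Require Import complex.
From mathcomp Require Import spectral ring lra.
Import Order.TTheory GRing.Theory Num.Theory.
Local Open Scope ring_scope.
Local Open Scope classical_set_scope.
Local Open Scope ereal_scope.

(* Upper bounds: with [W = diag(mu_0, ..., mu_(d-1), 1)], of trace 2, every state
   satisfies [N(rho) <= W]. Polarised, this is a bound on the trilinear form with
   entries [|V b e a|]; as these are nonnegative, it tensorises by induction, so
   [N^n(rho) <= W^n] with [tr W^n = 2^n]. Klein's inequality against [W^n / 2^n]
   then bounds the Holevo information by [n], and concavity of the entropy of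
   the environment bounds the private information by the Holevo information.
   Lower bounds: the inputs [|0><0|] and [diag(0, mu)] have outputs with
   orthogonal supports while the environment receives [diag(mu)] in both cases,
   so each use of the channel sends one perfectly private bit.
   Entanglement-assisted capacity: Klein's inequality is applied to [N(rho)], to
   [rho] and to [diag(mu)], the last two in a basis diagonalising [N^c(rho)]. *)

Section OneParameter.
Set Implicit Arguments.
Unset Strict Implicit.
Unset Printing Implicit Defensive.
Local Open Scope ring_scope.
Local Open Scope complex_scope.
Variable R : realType.
Local Notation C := R[i].
Implicit Types (I A B E S : finType).

(** * Squared moduli, inner products and orthonormal bases *)

Definition sqnorm (z : C) : R := complex.Re (z * conjc z).

Lemma sqnormE (z : C) : (sqnorm z)%:C = z * conjc z.
Proof. by apply/RRe_real/ger0_real/mulcJ_ge0. Qed.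

Lemma sqnorm_ge0 (z : C) : 0 <= sqnorm z.
Proof. by rewrite -ler0c sqnormE mulcJ_ge0. Qed.

Lemma sqnorm0 : sqnorm 0 = 0.
Proof. by rewrite /sqnorm mul0r. Qed.

Lemma sqnormM (y z : C) : sqnorm (y * z) = sqnorm y * sqnorm z.
Proof. by apply: complexI; rewrite rmorphM /= !sqnormE rmorphM /=; ring. Qed.

Lemma sqnorm_real (x : R) : sqnorm x%:C = x ^+ 2.
Proof. by rewrite /sqnorm conjc_real -rmorphM expr2. Qed.

Lemma sqnormJ (z : C) : sqnorm (conjc z) = sqnorm z.
Proof. by rewrite /sqnorm conjcK mulrC. Qed.

Lemma Re_sum I (P : pred I) (F : I -> C) :
  complex.Re (\sum_(i | P i) F i) = \sum_(i | P i) complex.Re (F i).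
Proof. by elim/big_rec2 : _ => // i x y _ <-; case: (F i); case: y. Qed.

Lemma ReMr (x : R) (z : C) : complex.Re (x%:C * z) = x * complex.Re z.
Proof. by case: z => a b /=; rewrite mul0r subr0. Qed.

Definition dot I (v w : I -> C) : C := \sum_i conjc (v i) * w i.

Lemma dot_conj I (v w : I -> C) : conjc (dot v w) = dot w v.
Proof.
rewrite /dot rmorph_sum; apply: eq_bigr => i _; rewrite rmorphM /=. by rewrite conjcK mulrC.
Qed.

(** The vectors [U k] are indexed by the same type as the coordinates, so orthonormality already
    makes the family a basis. *)
Definition onb I (U : I -> I -> C) := forall k l, dot (U k) (U l) = (k == l)%:R.

(** Orthonormality makes one product of two square matrices the identity; the product in the other
    order is then the identity too, which is the resolution of the identity. *)
Lemma onb_complete I (U : I -> I -> C) : onb U ->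
  forall i j, \sum_k U k i * conjc (U k j) = (i == j)%:R.
Proof.
move=> oU i j.
pose M : 'M[C]_#|I| := \matrix_(a, b) conjc (U (enum_val a) (enum_val b)).
pose N : 'M[C]_#|I| := \matrix_(a, b) U (enum_val b) (enum_val a).
have MN : M *m N = 1%:M.
  apply/matrixP=> a b; rewrite !mxE.
  transitivity (dot (U (enum_val a)) (U (enum_val b))).
    rewrite /dot (big_enum_val (A := I) (fun x => conjc (U (enum_val a) x) * U (enum_val b) x)).
    by apply: eq_bigr => c _; rewrite !mxE.
  by rewrite oU (inj_eq enum_val_inj).
have /matrixP/(_ (enum_rank i) (enum_rank j)) := mulmx1C MN.
rewrite !mxE (inj_eq enum_rank_inj) => <-.
rewrite (big_enum_val (A := I) (fun k => U k i * conjc (U k j))).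
by apply: eq_bigr => c _; rewrite !mxE !enum_rankK.
Qed.

Lemma parseval I (V : I -> I -> C) (u : I -> C) : onb V ->
  \sum_x sqnorm (dot u (V x)) = \sum_i sqnorm (u i).
Proof.
move=> oV; apply: complexI; rewrite !rmorph_sum /=.
under eq_bigr do rewrite sqnormE dot_conj /dot big_distrlr /=.
rewrite exchange_big /=; apply: eq_bigr => i _; rewrite exchange_big /=.
transitivity (\sum_j conjc (u i) * u j * (i == j)%:R).
  apply: eq_bigr => j _; rewrite -(onb_complete oV) mulr_sumr.
  by apply: eq_bigr => x _; ring.
rewrite (bigD1 i) //= eqxx big1 ?addr0; first by rewrite mulr1 sqnormE mulrC.
by move=> j /negbTE; rewrite eq_sym => ->; rewrite mulr0.
Qed.

Lemma onb_unit I (V : I -> I -> C) k : onb V -> \sum_i sqnorm (V k i) = 1.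
Proof.
move=> oV; apply: complexI; rewrite rmorph_sum /=.
transitivity (dot (V k) (V k)); last by rewrite oV eqxx.
by apply: eq_bigr => i _; rewrite sqnormE mulrC.
Qed.

Lemma dot_delta I (u : I -> C) x : dot u (fun i => (x == i)%:R) = conjc (u x).
Proof.
rewrite /dot (bigD1 x) //= eqxx mulr1 big1 ?addr0 // => i /negbTE.
by rewrite eq_sym => ->; rewrite mulr0.
Qed.

Lemma onb_delta I : onb (fun (x i : I) => (x == i)%:R).
Proof. by move=> k l; rewrite dot_delta conjc_nat eq_sym. Qed.

(** * Quadratic forms, positivity and the spectral theorem *)

Definition qform I (T : op R I) (v : I -> C) : C :=
  \sum_i \sum_j conjc (v i) * T i j * v j.

Lemma qform_delta I (T : op R I) x : qform T (fun i => (x == i)%:R) = T x x.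
Proof.
rewrite /qform (bigD1 x) //= [X in _ + X]big1 ?addr0; last first.
  move=> i /negbTE; rewrite eq_sym => ->; apply: big1 => j _.
  by rewrite conjc0 !mul0r.
rewrite (bigD1 x) //= eqxx conjc1 mul1r mulr1 big1 ?addr0 // => i /negbTE.
by rewrite eq_sym => ->; rewrite mulr0.
Qed.

Lemma trace_onb I (T : op R I) (V : I -> I -> C) : onb V ->
  \sum_x qform T (V x) = \sum_i T i i.
Proof.
move=> oV; rewrite exchange_big; apply: eq_bigr => i _; rewrite exchange_big /=.
transitivity (\sum_j T i j * (j == i)%:R).
  apply: eq_bigr => j _; rewrite -(onb_complete oV) mulr_sumr.
  by apply: eq_bigr => x _; ring.
rewrite (bigD1 i) //= eqxx mulr1 big1 ?addr0 // => j /negbTE ->.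
by rewrite mulr0.
Qed.

Definition spectral_form I (T : op R I) (U : I -> I -> C) (l : I -> R) :=
  forall i j, T i j = \sum_k (l k)%:C * U k i * conjc (U k j).

Definition psd I (T : op R I) := forall v, 0 <= qform T v.

(** In [C], [0 <= z] forces [z] to be real. Basis vectors make the diagonal real; the vectors
    [e_i + c e_j] then constrain the off-diagonal pair. *)
Lemma psd_herm I (T : op R I) : psd T -> forall i j, T j i = conjc (T i j).
Proof.
move=> pT i j.
have real_pp x : complex.Im (T x x) = 0.
  by have := ger0_Im (pT (fun i => (x == i)%:R)); rewrite qform_delta.
case: (eqVneq i j) => [<-|ij].
  by have := real_pp i; case: (T i i) => a b /= ->; rewrite oppr0.
have key c : complex.Im (conjc c * T j i + T i j * c) = 0.
  pose v k : C := if k == i then 1 else if k == j then c else 0.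
  have split2 (F : I -> C) : \sum_l F l * v l = F i + F j * c.
    rewrite (bigD1 i) //= (bigD1 j) /=; last by rewrite eq_sym.
    rewrite /v !eqxx (negbTE (_ : j != i)) ?[j == i]eq_sym // big1 ?addr0 ?mulr1 //.
    by move=> l /andP[/negbTE -> /negbTE ->]; rewrite mulr0.
  have split2c (F : I -> C) : \sum_l conjc (v l) * F l = F i + conjc c * F j.
    rewrite (bigD1 i) //= (bigD1 j) /=; last by rewrite eq_sym.
    rewrite /v !eqxx (negbTE (_ : j != i)) ?[j == i]eq_sym // big1 ?addr0 ?conjc1 ?mul1r //.
    by move=> l /andP[/negbTE -> /negbTE ->]; rewrite conjc0 mul0r.
  have := ger0_Im (pT v).
  have -> : qform T v = \sum_k conjc (v k) * \sum_l T k l * v l.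
    by apply: eq_bigr => k _; rewrite mulr_sumr; apply: eq_bigr => l _; rewrite mulrA.
  rewrite split2c !split2.
  have -> : T i i + T i j * c + conjc c * (T j i + T j j * c) =
            T i i + (sqnorm c)%:C * T j j + (conjc c * T j i + T i j * c).
    by rewrite sqnormE; ring.
  move=> H; rewrite -[RHS]H.
  have := real_pp i; have := real_pp j.
  case: (T i i) (T j j) => [a b] [a' b'] /= -> ->.
  by case: (_ + _) => x y /=; ring.
(* [c = 1] makes the two imaginary parts opposite, [c = i] makes the two real parts equal. *)
have := key 1; have := key 'i%C; case: (T i j) => a b; case: (T j i) => a' b' /=.
move=> h1 h2; apply/eqP; rewrite eq_complex /=.
by apply/andP; split; apply/eqP; lra.
Qed.

Lemma spectralP I (T : op R I) : (forall i j, T j i = conjc (T i j)) ->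
  exists (U : I -> I -> C) (l : I -> R), onb U /\ spectral_form T U l.
Proof.
move=> hT; pose M := mxof T.
have hM : M \is hermsymmx.
  apply/is_hermitianmxP; rewrite expr0 scale1r; apply/matrixP => i j.
  by rewrite !mxE hT.
have /orthomx_spectralP := hermitian_normalmx hM.
have uP := spectral_unitarymx M; have := hermitian_spectral_diag_real hM.
move: (spectralmx M) (spectral_diag M) uP => P D uP rD.
rewrite (invmx_unitary uP) => eM.
(* The matrix reads [P^* D P] with [P] unitary, so its eigenvectors are the conjugated rows of
   [P]. *)
exists (fun k i => conjc (P (enum_rank k) (enum_rank i))).
exists (fun k => complex.Re (D 0 (enum_rank k))); split.
  move=> k l; have /unitarymxP/matrixP/(_ (enum_rank k) (enum_rank l)) := uP.
  rewrite !mxE (inj_eq enum_rank_inj) => <-.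
  rewrite /dot (reindex enum_rank) /=; last exact/onW_bij/enum_rank_bij.
  by apply: eq_bigr => i _; rewrite !mxE conjcK.
move=> i j; have /matrixP/(_ (enum_rank i) (enum_rank j)) := eM.
rewrite !mxE !enum_rankK => ->.
rewrite (reindex enum_rank) /=; last exact/onW_bij/enum_rank_bij.
apply: eq_bigr => k _; rewrite conjcK; congr (_ * _).
rewrite mxE (bigD1 (enum_rank k)) //= big1 ?addr0.
  rewrite !mxE eqxx mulr1n mulrC; congr (_ * _).
  by rewrite RRe_real //; apply: (mxOverP rD).
by move=> a /negbTE ak; rewrite !mxE ak mulr0n mulr0.
Qed.

(** * Entropy in terms of a spectral decomposition *)

Lemma char_poly_conj n (P Q D : 'M[C]_n) : Q *m P = 1%:M ->
  char_poly (Q *m D *m P) = char_poly D.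
Proof.
move=> QP; rewrite /char_poly.
pose P' := map_mx polyC P; pose Q' := map_mx polyC Q.
have QP' : Q' *m P' = 1%:M by rewrite -map_mxM QP map_mx1.
have -> : char_poly_mx (Q *m D *m P) = Q' *m char_poly_mx D *m P'.
  rewrite /char_poly_mx mulmxBr mulmxBl !map_mxM; congr (_ - _).
  by rewrite scalar_mxC -mulmxA QP' mulmx1.
by rewrite !det_mulmx mulrC mulrA -det_mulmx (mulmx1C QP') det1 mul1r.
Qed.

(** [spectrum] is some list of roots of the characteristic polynomial. Unitary conjugation to
    [diag l] factors that polynomial over the values of [l], and equal products of [X - z] have the
    same roots up to permutation. The default value at 0 agrees with [0 * log2 0 = 0]. *)
Lemma vN_spectral I (T : op R I) U l : onb U -> spectral_form T U l ->
  vN_entropy T = \sum_k - (l k * log2 (l k)).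
Proof.
move=> oU fT.
pose Q : 'M[C]_#|I| := \matrix_(i, k) U (enum_val k) (enum_val i).
pose P : 'M[C]_#|I| := \matrix_(k, i) conjc (U (enum_val k) (enum_val i)).
pose D : 'M[C]_#|I| := diag_mx (\row_k (l (enum_val k))%:C).
have QP : Q *m P = 1%:M.
  apply/matrixP => i j; rewrite !mxE.
  rewrite -(inj_eq enum_val_inj) -(onb_complete oU).
  rewrite (big_enum_val (A := I) (fun k => U k (enum_val i) * conjc (U k (enum_val j)))).
  by apply: eq_bigr => c _; rewrite !mxE.
have eM : mxof T = Q *m D *m P.
  apply/matrixP => i j; rewrite !mxE fT.
  rewrite (big_enum_val (A := I) (fun k => (l k)%:C * U k (enum_val i) * conjc (U k (enum_val j)))).
  apply: eq_bigr => k _; rewrite !mxE; congr (_ * _).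
  rewrite (bigD1 k) //= big1 ?addr0; first by rewrite !mxE eqxx mulr1n mulrC.
  by move=> a /negbTE ak; rewrite !mxE ak mulr0n mulr0.
have cpT : char_poly (mxof T) = \prod_(z <- [seq (l k)%:C | k <- enum I]) ('X - z%:P).
  rewrite eM (char_poly_conj _ QP) char_poly_trig ?diag_mx_is_trig //.
  rewrite big_map big_enum /= (big_enum_val (A := I) (fun k => 'X - ((l k)%:C)%:P)).
  by apply: eq_bigr => k _; rewrite !mxE eqxx mulr1n.
have /(perm_big _) : perm_eq (spectrum T) [seq (l k)%:C | k <- enum I].
  apply: prod_XsubC_eq; rewrite -cpT /spectrum.
  case: closed_field_poly_normal => s /= es; rewrite [RHS]es.
  by rewrite (monicP (char_poly_monic _)) scale1r.
rewrite /vN_entropy => ->; rewrite big_map big_enum /=.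
by apply: eq_bigr => k _; case: eqP => [->|_]; rewrite ?mul0r ?oppr0 ?mulNr.
Qed.

Lemma qform_spectral I (T : op R I) U l v : spectral_form T U l ->
  qform T v = (\sum_k l k * sqnorm (dot (U k) v))%:C.
Proof.
move=> fT; rewrite rmorph_sum /=.
under [RHS]eq_bigr do rewrite rmorphM /= sqnormE dot_conj /dot big_distrlr /= mulr_sumr.
rewrite exchange_big /= /qform exchange_big /=; apply: eq_bigr => j _.
under [RHS]eq_bigr do rewrite mulr_sumr.
rewrite exchange_big /=; apply: eq_bigr => i _.
rewrite fT mulr_sumr mulr_suml; apply: eq_bigr => k _; ring.
Qed.

Lemma qform_spectral_eigen I (T : op R I) U l k : onb U -> spectral_form T U l ->
  qform T (U k) = (l k)%:C.
Proof.
move=> oU fT; rewrite (qform_spectral _ fT) (bigD1 k) //= big1 => [|j /negbTE jk].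
  by rewrite oU eqxx addr0 /sqnorm conjc1 mulr1 /= mulr1.
by rewrite oU jk sqnorm0 mulr0.
Qed.

Lemma psd_spectralP I (T : op R I) : psd T ->
  exists (U : I -> I -> C) (l : I -> R),
    [/\ onb U, spectral_form T U l & forall k, 0 <= l k].
Proof.
move=> pT; have [U [l [oU fT]]] := spectralP (psd_herm pT).
exists U, l; split=> // k.
by rewrite -ler0c -(qform_spectral_eigen k oU fT).
Qed.

Lemma trace_spectral I (T : op R I) U l : onb U -> spectral_form T U l ->
  \sum_i T i i = (\sum_k l k)%:C.
Proof.
move=> oU fT; under eq_bigr do rewrite fT.
rewrite exchange_big rmorph_sum /=; apply: eq_bigr => k _.
under eq_bigr do rewrite -mulrA -sqnormE.
by rewrite -mulr_sumr -rmorph_sum /= (onb_unit k oU) mulr1.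
Qed.

(** * Klein's inequality and entropy under domination *)

(** This is [ln t <= t - 1] at [t = b / a], scaled by [a]; both entropy inequalities below reduce to
    it term by term. *)
Lemma log2_gap (a b : R) : 0 < a -> 0 < b -> a - b <= a * (ln a - ln b).
Proof.
move=> a0 b0.
have h : ln (b / a) <= b / a - 1.
  have := @le_ln1Dx R (b / a - 1); rewrite [1 + _]addrC subrK => -> //.
  by rewrite ltrBrDr addrC subrr divr_gt0.
have -> : a - b = a * (1 - b / a).
  by rewrite mulrBr mulr1 mulrCA divff ?mulr1 // gt_eqF.
rewrite ler_pM2l //; move: h; rewrite ln_div ?posrE //; lra.
Qed.

Lemma ln2_gt0 : 0 < ln 2 :> R.
Proof. by apply: ln_gt0; rewrite ltr1n. Qed.

(* Klein's inequality, tested on an orthonormal basis [V]; where [s x = 0] the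
   junk value [log2 0 = 0] is harmless because the form vanishes there. *)
Lemma klein I (T : op R I) (V : I -> I -> C) (s : I -> R) :
  psd T -> onb V -> (forall x, 0 <= s x) ->
  (\sum_x s x)%:C <= \sum_i T i i ->
  (forall x, s x = 0 -> qform T (V x) = 0) ->
  vN_entropy T <= - \sum_x complex.Re (qform T (V x)) * log2 (s x).
Proof.
move=> pT oV s0 trs supp.
have [U [l [oU fT l0]]] := psd_spectralP pT.
rewrite (vN_spectral oU fT) sumrN lerN2.
(* The overlaps of the two bases form a doubly stochastic matrix, over which both sides can be
   written as double sums. *)
pose q k x := sqnorm (dot (U k) (V x)).
have q0 k x : 0 <= q k x by exact: sqnorm_ge0.
have q1 k : \sum_x q k x = 1 by rewrite /q parseval // onb_unit.
have q1' x : \sum_k q k x = 1.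
  rewrite -(onb_unit x oV) -(parseval (V x) oU); apply: eq_bigr => k _.
  by rewrite /q -dot_conj sqnormJ.
have qfE x : complex.Re (qform T (V x)) = \sum_k l k * q k x.
  by rewrite (qform_spectral _ fT).
under eq_bigr do rewrite qfE mulr_suml.
have eL : \sum_k l k * log2 (l k) = \sum_x \sum_k l k * q k x * log2 (l k).
  rewrite exchange_big; apply: eq_bigr => k _ /=.
  by rewrite -mulr_suml -mulr_sumr q1 mulr1.
rewrite eL -subr_ge0 -sumrB.
(* By double stochasticity this is [(tr T - sum s) / ln 2], nonnegative by the trace hypothesis. It
   bounds the difference term by term through [log2_gap]; a term with [q, l > 0] but [s x = 0] would
   make the form at [V x] positive, against the support hypothesis. *)
have key : \sum_x \sum_k q k x * (l k - s x) / ln 2 >= 0.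
  under eq_bigr do rewrite -mulr_suml.
  rewrite -mulr_suml divr_ge0 ?(ltW ln2_gt0) //.
  under eq_bigr do under eq_bigr do rewrite mulrBr.
  under eq_bigr do rewrite sumrB.
  rewrite sumrB exchange_big /=.
  under eq_bigr do rewrite -mulr_suml q1 mul1r.
  under [X in _ - X]eq_bigr do rewrite -mulr_suml q1' mul1r.
  by rewrite subr_ge0 -lecR -(trace_spectral oU fT).
apply: le_trans key _; apply: ler_sum => x _; rewrite -sumrB; apply: ler_sum => k _.
rewrite /log2 [X in _ <= X](_ : _ = q k x * (l k * (ln (l k) - ln (s x))) / ln 2); last by ring.
rewrite ler_pM2r ?invr_gt0 ?ln2_gt0 //.
have [q_gt0|] := ltP 0 (q k x); last first.
  by move=> qle; have -> : q k x = 0 by [apply/le_anti; rewrite qle q0]; rewrite !mul0r.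
rewrite ler_pM2l //.
have [l_gt0|] := ltP 0 (l k); last first.
  move=> lle; have -> : l k = 0 by apply/le_anti; rewrite lle l0.
  by rewrite mul0r sub0r oppr_le0.
apply: log2_gap => //; rewrite lt_def s0 andbT; apply/eqP => sx0.
have : complex.Re (qform T (V x)) = 0 by rewrite supp.
rewrite qfE => /eqP; rewrite psumr_eq0; last by move=> j _; rewrite mulr_ge0.
move=> /allP/(_ k); rewrite mem_index_enum => /(_ isT) /=.
by rewrite mulf_eq0 (gt_eqF l_gt0) (gt_eqF q_gt0).
Qed.

(* If [T <= diag W], then [tr T (log T - log W) <= 0]: an eigenvector [u] of [T]
   for [l > 0] satisfies [l * <u, W^-1 u> <= 1], which is the hypothesis tested
   on [W^-1 u]; conclude by [ln t <= t - 1]. *)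
Lemma neg_entropy_dominated I (T : op R I) (W : I -> R) :
  psd T -> (forall x, 0 <= W x) ->
  (forall v, complex.Re (qform T v) <= \sum_x W x * sqnorm (v x)) ->
  - vN_entropy T <= \sum_x complex.Re (T x x) * log2 (W x).
Proof.
move=> pT W0 dom.
have [U [l [oU fT l0]]] := psd_spectralP pT.
rewrite (vN_spectral oU fT) sumrN opprK.
have TE x : complex.Re (T x x) = \sum_k l k * sqnorm (U k x).
  rewrite fT Re_sum; apply: eq_bigr => k _.
  by rewrite -mulrA -sqnormE -rmorphM.
under [X in _ <= X]eq_bigr do rewrite TE mulr_suml.
rewrite exchange_big /=; apply: ler_sum => k _.
have [l_gt0|] := ltP 0 (l k); last first.
  move=> lle; have -> : l k = 0 by apply/le_anti; rewrite lle l0.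
  by rewrite mul0r big1 // => x _; rewrite !mul0r.
under eq_bigr do rewrite -mulrA.
rewrite -mulr_sumr ler_pM2l //.
(* The domination tested on the basis vector at [x] makes the eigenvector vanish wherever [W] does,
   so the default values [0^-1 = 0] and [log2 0 = 0] cost nothing. *)
have U0 x : W x = 0 -> sqnorm (U k x) = 0.
  move=> Wx0; have := dom (fun i => (x == i)%:R); rewrite qform_delta TE.
  rewrite [X in _ <= X]big1; last first.
    move=> i _; have [<-|_] := eqVneq x i; first by rewrite Wx0 mul0r.
    by rewrite sqnorm0 mulr0.
  rewrite (bigD1 k) //= => h; apply/le_anti; rewrite sqnorm_ge0 andbT.
  rewrite -(pmulr_rle0 _ l_gt0); apply: le_trans h; rewrite lerDl.
  by apply: sumr_ge0 => j _; rewrite mulr_ge0 ?sqnorm_ge0.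
pose c := \sum_x sqnorm (U k x) / W x.
have c_le : l k * c <= 1.
  have c0 : 0 <= c by apply: sumr_ge0 => x _; rewrite divr_ge0 ?sqnorm_ge0.
  have [c_gt0|] := ltP 0 c; last first.
    by move=> cle; have -> : c = 0 by [apply/le_anti; rewrite cle c0]; rewrite mulr0 ler01.
  have := dom (fun x => (W x)^-1%:C * U k x).
  have -> : \sum_x W x * sqnorm ((W x)^-1%:C * U k x) = c.
    apply: eq_bigr => x _.
    have -> : sqnorm ((W x)^-1%:C * U k x) = (W x)^-1 ^+ 2 * sqnorm (U k x).
      by rewrite sqnormM sqnorm_real.
    have [->|Wx] := eqVneq (W x) 0; first by rewrite invr0 !mul0r mulr0.
    by field.
  rewrite (qform_spectral _ fT) /= (bigD1 k) //=.
  have -> : dot (U k) (fun x => (W x)^-1%:C * U k x) = c%:C.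
    rewrite /dot rmorph_sum /=; apply: eq_bigr => x _.
    by rewrite rmorphM /= sqnormE; ring.
  move=> h; rewrite -(ler_pM2r c_gt0) mul1r -mulrA -expr2; apply: le_trans h.
  rewrite sqnorm_real lerDl; apply: sumr_ge0 => j _; rewrite mulr_ge0 ?sqnorm_ge0 //.
rewrite -subr_ge0.
have -> : \sum_x sqnorm (U k x) * log2 (W x) - log2 (l k) =
          (\sum_x sqnorm (U k x) * (ln (W x) - ln (l k))) / ln 2.
  under [in RHS]eq_bigr do rewrite mulrBr.
  rewrite sumrB -mulr_suml (onb_unit k oU) mul1r mulrBl; congr (_ - _).
  by rewrite mulr_suml; apply: eq_bigr => x _; rewrite /log2 mulrA.
rewrite divr_ge0 ?(ltW ln2_gt0) //.
have : 0 <= 1 - l k * c by rewrite subr_ge0.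
move=> /le_trans; apply; rewrite -(onb_unit k oU) /c mulr_sumr -sumrB.
apply: ler_sum => x _.
have [Wx0|Wx] := eqVneq (W x) 0; first by rewrite U0 // !mul0r mulr0 subr0.
have Wgt : 0 < W x by rewrite lt_def Wx W0.
have -> : sqnorm (U k x) - l k * (sqnorm (U k x) / W x) =
          sqnorm (U k x) * ((W x - l k) / W x) by field.
apply: ler_wpM2l; first exact: sqnorm_ge0.
by rewrite ler_pdivrMr // mulrC log2_gap.
Qed.

(** * Channels given by isometries, ensembles and concavity of entropy *)

Definition isometry A B E (V : isom R A B E) :=
  forall a a', \sum_b \sum_e conjc (V b e a) * V b e a' = (a == a')%:R.

(** [cchan V] is [chan (swap V)] by conversion, so facts about outputs transfer to the
    environment. *)
Definition swap A B E (V : isom R A B E) : isom R A E B := fun e b a => V b e a.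

Lemma isometry_swap A B E (V : isom R A B E) : isometry V -> isometry (swap V).
Proof. by move=> iV a a'; rewrite exchange_big; exact: iV. Qed.

(** This is [K_e^* v] for the Kraus operator [K_e = <e|V], so the form of [N(rho)] at [v] is the sum
    over [e] of the forms of [rho] at these vectors. *)
Definition pullback A B E (V : isom R A B E) (v : B -> C) (e : E) : A -> C :=
  fun a => \sum_b conjc (V b e a) * v b.

Lemma qform_chan A B E (V : isom R A B E) (rho : op R A) v :
  qform (chan V rho) v = \sum_e qform rho (pullback V v e).
Proof.
rewrite /qform /pullback.
under [RHS]eq_bigr => e _.
  under eq_bigr => a _.
    under eq_bigr => a' _.
      rewrite rmorph_sum mulr_suml big_distrlr /=.
      under eq_bigr do under eq_bigr do rewrite rmorphM /= conjcK.
    over.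
    rewrite exchange_big /=.
    under eq_bigr do rewrite exchange_big /=.
  over.
  rewrite exchange_big /=.
  under eq_bigr do rewrite exchange_big /=.
over.
rewrite [RHS]exchange_big /=; apply: eq_bigr => b _.
rewrite [RHS]exchange_big /=; apply: eq_bigr => b' _.
rewrite /chan mulr_sumr mulr_suml; apply: eq_bigr => e _.
rewrite mulr_sumr mulr_suml; apply: eq_bigr => a _.
rewrite mulr_sumr mulr_suml; apply: eq_bigr => a' _.
by rewrite /=; ring.
Qed.

Lemma psd_chan A B E (V : isom R A B E) (rho : op R A) :
  psd rho -> psd (chan V rho).
Proof. by move=> h v; rewrite qform_chan sumr_ge0. Qed.

Lemma trace_chan A B E (V : isom R A B E) (rho : op R A) : isometry V ->
  \sum_b chan V rho b b = \sum_a rho a a.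
Proof.
move=> iV; rewrite /chan.
transitivity (\sum_a \sum_a' rho a a' * (a' == a)%:R).
  under eq_bigr do rewrite exchange_big /=.
  rewrite exchange_big /=; apply: eq_bigr => a _.
  under eq_bigr do rewrite exchange_big /=.
  rewrite exchange_big /=; apply: eq_bigr => a' _.
  rewrite -iV mulr_sumr; apply: eq_bigr => b _.
  rewrite mulr_sumr; apply: eq_bigr => e _; ring.
apply: eq_bigr => a _; rewrite (bigD1 a) //= eqxx mulr1 big1 ?addr0 //.
by move=> a' /negbTE ->; rewrite mulr0.
Qed.

Lemma state_chan A B E (V : isom R A B E) (rho : op R A) : isometry V ->
  is_state rho -> is_state (chan V rho).
Proof.
move=> iV [p1 t1]; split; first exact: psd_chan.
by rewrite trace_chan.
Qed.

Lemma state_cchan A B E (V : isom R A B E) (rho : op R A) : isometry V ->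
  is_state rho -> is_state (cchan V rho).
Proof. by move=> iV; exact: (state_chan (isometry_swap iV)). Qed.

Lemma chan_avg A B E (V : isom R A B E) m (p : 'I_m -> R) (rho : 'I_m -> op R A) :
  chan V (avg p rho) = avg p (fun i => chan V (rho i)).
Proof.
apply/funext => b; apply/funext => b'; rewrite /chan /avg.
under eq_bigr => e _.
  under eq_bigr => a _.
    under eq_bigr do rewrite mulr_sumr mulr_suml.
    rewrite exchange_big /=.
  over.
  rewrite exchange_big /=.
over.
rewrite exchange_big /=; apply: eq_bigr => i _.
rewrite mulr_sumr; apply: eq_bigr => e _.
rewrite mulr_sumr; apply: eq_bigr => a _.
rewrite mulr_sumr; apply: eq_bigr => a' _; ring.
Qed.

Lemma cchan_avg A B E (V : isom R A B E) m (p : 'I_m -> R) (rho : 'I_m -> op R A) :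
  cchan V (avg p rho) = avg p (fun i => cchan V (rho i)).
Proof. exact: (chan_avg (swap V)). Qed.

Lemma qform_avg A m (p : 'I_m -> R) (rho : 'I_m -> op R A) v :
  qform (avg p rho) v = \sum_i (p i)%:C * qform (rho i) v.
Proof.
rewrite /qform /avg.
under [RHS]eq_bigr => i _.
  rewrite mulr_sumr; under eq_bigr do rewrite mulr_sumr.
over.
rewrite [RHS]exchange_big /=; apply: eq_bigr => a _.
rewrite [RHS]exchange_big /=; apply: eq_bigr => a' _.
rewrite mulr_sumr mulr_suml; apply: eq_bigr => i _; ring.
Qed.

Lemma state_avg A m (p : 'I_m -> R) (rho : 'I_m -> op R A) :
  is_ensemble p rho -> is_state (avg p rho).
Proof.
move=> [p0 [p1 st]]; split.
  move=> v; have := qform_avg p rho v; rewrite /qform => ->.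
  apply: sumr_ge0 => i _; rewrite mulr_ge0 ?ler0c //; exact: (st i).1.
rewrite exchange_big /=.
under eq_bigr => i _ do rewrite -mulr_sumr (st i).2 mulr1.
by rewrite -rmorph_sum p1.
Qed.

Lemma state_trace_Re I (T : op R I) : is_state T -> \sum_x complex.Re (T x x) = 1.
Proof. by move=> [_ t1]; rewrite -Re_sum t1. Qed.

(** Apply [klein] to each [T i] on the eigenbasis of the average, with the eigenvalues of the
    average as weights; the averaged right-hand sides add up to the entropy of the average. *)
Lemma vN_concave I m (p : 'I_m -> R) (T : 'I_m -> op R I) :
  is_ensemble p T -> \sum_i p i * vN_entropy (T i) <= vN_entropy (avg p T).
Proof.
move=> ens; have [p0 [p1 st]] := ens; have [pT tT] := state_avg ens.
have [V [s [oV fT s0]]] := psd_spectralP (pT : psd _).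
have trs : (\sum_x s x)%:C = 1 by rewrite -tT (trace_spectral oV fT).
have sE x : s x = \sum_i p i * complex.Re (qform (T i) (V x)).
  have := qform_spectral_eigen x oV fT; rewrite qform_avg => /(congr1 (@complex.Re R)) /= <-.
  by rewrite Re_sum; apply: eq_bigr => i _; rewrite ReMr.
have q0 i x : 0 <= complex.Re (qform (T i) (V x)).
  by have := (st i).1 (V x); rewrite lecE => /andP[].
apply: (@le_trans _ _ (\sum_i p i * - \sum_x complex.Re (qform (T i) (V x)) * log2 (s x))).
  apply: ler_sum => i _; have [->|pi] := eqVneq (p i) 0; first by rewrite !mul0r.
  apply: ler_wpM2l => //; apply: klein => //; first exact: (st i).1.
    by rewrite trs (st i).2.
  (* A zero eigenvalue of the average is a vanishing sum of nonnegative terms, so every member of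
     nonzero probability has zero form at [V x]. *)
  move=> x sx0; have := (st i).1 (V x); rewrite -/(qform (T i) (V x)) => qge.
  apply/eqP; rewrite eq_complex (ger0_Im qge) eqxx andbT /=.
  move: sx0; rewrite sE => /eqP; rewrite psumr_eq0; last by move=> j _; rewrite mulr_ge0.
  by move=> /allP/(_ i); rewrite mem_index_enum mulf_eq0 (negbTE pi) => /(_ isT).
rewrite (vN_spectral oV fT) le_eqVlt; apply/orP; left; apply/eqP.
under eq_bigr do rewrite mulrN mulr_sumr.
rewrite sumrN exchange_big /= -sumrN; apply: eq_bigr => x _.
by congr (- _); rewrite [X in _ = X * _]sE mulr_suml; apply: eq_bigr => i _; rewrite mulrA.
Qed.

(** The gap is the Holevo information of the complementary channel, nonnegative by concavity. *)
Lemma Ipriv_le_Holevo A B E (V : isom R A B E) m (p : 'I_m -> R)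
    (rho : 'I_m -> op R A) : isometry V -> is_ensemble p rho ->
  Ipriv V p rho <= Holevo V p rho.
Proof.
move=> iV [p0 [p1 st]]; rewrite /Ipriv /Holevo /Icoh.
under [X in _ - _ - X]eq_bigr do rewrite mulrBr.
rewrite sumrB.
have : \sum_i p i * vN_entropy (cchan V (rho i)) <= vN_entropy (cchan V (avg p rho)).
  rewrite cchan_avg; apply: vN_concave; split => //; split => // i.
  exact: state_cchan.
lra.
Qed.

(** * The trilinear bound and the resulting Holevo bound *)

Definition l2norm I (w f : I -> R) := Num.sqrt (\sum_i w i * f i ^+ 2).

Lemma l2norm_ge0 I (w f : I -> R) : 0 <= l2norm w f.
Proof. exact: sqrtr_ge0. Qed.

Lemma sqr_l2norm I (w f : I -> R) : (forall i, 0 <= w i) ->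
  l2norm w f ^+ 2 = \sum_i w i * f i ^+ 2.
Proof. by move=> w0; rewrite sqr_sqrtr // sumr_ge0 // => i _; rewrite mulr_ge0 ?sqr_ge0. Qed.

(* The trilinear form of [|V|] has norm at most 1 for the weight [W] on the
   output: since the entries of [|V|] are nonnegative, this is multiplicative
   under tensor powers, and it entails [N(rho) <= diag W] for every state. *)
Definition trilinear_bound A B E (V : isom R A B E) (W : B -> R) :=
  forall f h g, (forall b, 0 <= f b) -> (forall e, 0 <= h e) -> (forall a, 0 <= g a) ->
  \sum_b \sum_e \sum_a Normc.normc (V b e a) * (f b * h e * g a) <=
  l2norm W f * l2norm (fun=> 1) h * l2norm (fun=> 1) g.

Lemma sqr_normc_sqnorm (z : C) : Normc.normc z ^+ 2 = sqnorm z.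
Proof.
case: z => a b; rewrite /Normc.normc sqr_sqrtr ?addr_ge0 ?sqr_ge0 //.
by rewrite /sqnorm /= mulrN opprK -!expr2.
Qed.

Lemma normc_ge0 (z : C) : 0 <= Normc.normc z.
Proof. by case: z => a b; exact: sqrtr_ge0. Qed.

Lemma normcJ (z : C) : Normc.normc (conjc z) = Normc.normc z.
Proof. by case: z => a b; rewrite /= sqrrN. Qed.

Lemma le_normc_sum I (F : I -> C) :
  Normc.normc (\sum_i F i) <= \sum_i Normc.normc (F i).
Proof.
elim/big_rec2 : _ => [|i x y _ h]; first by rewrite Normc.normc0.
by apply: le_trans (le_normcD _ _) _; rewrite lerD2l.
Qed.

(** Duality: with [z e] the inner product being summed, the trilinear bound at [|v|], [|z|], [|u|]
    gives [X <= sqrt Y * sqrt X], and [sqrt X] cancels. *)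
Lemma sqnorm_pullback A B E (V : isom R A B E) (W : B -> R) (u : A -> C) v :
  trilinear_bound V W -> (forall b, 0 <= W b) -> \sum_a sqnorm (u a) = 1 ->
  \sum_e sqnorm (dot u (pullback V v e)) <= \sum_b W b * sqnorm (v b).
Proof.
move=> bV W0 u1; set X := \sum_e _; set Y := \sum_b _.
pose z e := dot u (pullback V v e).
have X0 : 0 <= X by apply: sumr_ge0 => e _; exact: sqnorm_ge0.
have Y0 : 0 <= Y by apply: sumr_ge0 => b _; rewrite mulr_ge0 ?sqnorm_ge0.
have [X_gt0|] := ltP 0 X; last by move=> Xle; apply: le_trans Xle Y0.
suff : X <= Num.sqrt Y * Num.sqrt X.
  rewrite -{1}(sqr_sqrtr X0) expr2 ler_pM2r ?sqrtr_gt0 //.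
  by rewrite ler_sqrt.
have -> : Num.sqrt Y * Num.sqrt X =
    l2norm W (fun b => Normc.normc (v b)) * l2norm (fun=> 1) (fun e => Normc.normc (z e)) *
    l2norm (fun=> 1) (fun a => Normc.normc (u a)).
  have u1' : \sum_a 1 * Normc.normc (u a) ^+ 2 = 1.
    by under eq_bigr do rewrite mul1r sqr_normc_sqnorm.
  rewrite /l2norm u1' sqrtr1 mulr1; congr (Num.sqrt _ * Num.sqrt _).
    by apply: eq_bigr => b _; rewrite sqr_normc_sqnorm.
  by apply: eq_bigr => e _; rewrite mul1r sqr_normc_sqnorm.
apply: le_trans (bV _ _ _ _ _ _) => *; do ?exact: normc_ge0.
rewrite exchange_big /=; apply: ler_sum => e _.
rewrite -sqr_normc_sqnorm expr2 -/(z e) exchange_big /=.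
apply: (@le_trans _ _ (Normc.normc (z e) *
    \sum_a \sum_b Normc.normc (conjc (u a) * (conjc (V b e a) * v b)))).
  apply: ler_wpM2l; first exact: normc_ge0.
  apply: le_trans (le_normc_sum _) _; apply: ler_sum => a _.
  by rewrite /pullback mulr_sumr; exact: le_normc_sum.
rewrite mulr_sumr; apply: ler_sum => a _; rewrite mulr_sumr; apply: ler_sum => b _.
by rewrite !Normc.normcM !normcJ le_eqVlt; apply/orP; left; apply/eqP; ring.
Qed.

(** A state is a convex combination of its eigenprojections, so the bound for unit vectors
    suffices. *)
Lemma chan_dominated A B E (V : isom R A B E) (W : B -> R) (rho : op R A) v :
  trilinear_bound V W -> (forall b, 0 <= W b) -> is_state rho ->
  complex.Re (qform (chan V rho) v) <= \sum_b W b * sqnorm (v b).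
Proof.
move=> bV W0 [prho trho]; have [U [l [oU fT l0]]] := psd_spectralP (prho : psd rho).
have l1 : \sum_k l k = 1 by apply: complexI; rewrite -(trace_spectral oU fT).
rewrite qform_chan Re_sum.
under eq_bigr do rewrite (qform_spectral _ fT) /=.
rewrite exchange_big /= -[X in _ <= X]mul1r -l1 mulr_suml.
apply: ler_sum => k _; rewrite -mulr_sumr; apply: ler_wpM2l => //.
by apply: sqnorm_pullback => //; exact: onb_unit.
Qed.

(** With [M = sum W], Klein against [W / M] gives [S(tau) <= log M - sum tau_xx log W_x] for the
    average output [tau]. Domination bounds the negative entropy of each output by its own [log W]
    average; these average to the same sum, which cancels. *)
Lemma Holevo_le A B E (V : isom R A B E) (W : B -> R) m (p : 'I_m -> R)
    (rho : 'I_m -> op R A) :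
  isometry V -> trilinear_bound V W -> (forall b, 0 <= W b) ->
  0 < \sum_b W b -> is_ensemble p rho ->
  Holevo V p rho <= log2 (\sum_b W b).
Proof.
move=> iV bV W0 M0 ens; have [p0 [p1 st]] := ens; set M := \sum_b W b in M0 *.
have srho := state_avg ens; have stau := state_chan iV srho.
set tau := chan V (avg p rho) in stau.
have tau_ge x : 0 <= complex.Re (tau x x).
  by have := stau.1 (fun i => (x == i)%:R); rewrite -/(qform _ _) qform_delta lecE => /andP[].
(* Domination makes the diagonal of [tau] vanish on the zeros of [W]: this is Klein's support
   condition, and it neutralises [log2 0]. *)
have tau0 x : W x = 0 -> tau x x = 0.
  move=> Wx0; have := stau.1 (fun i => (x == i)%:R).
  rewrite -/(qform _ _) qform_delta => tx; apply/eqP.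
  rewrite eq_complex (ger0_Im tx) eqxx andbT /= eq_le tau_ge andbT.
  have := chan_dominated (fun i => (x == i)%:R) bV W0 srho.
  rewrite qform_delta => /le_trans; apply; rewrite big1 // => i _.
  by have [<-|_] := eqVneq x i; rewrite ?Wx0 ?mul0r // sqnorm0 mulr0.
have H1 : vN_entropy tau <= - \sum_x complex.Re (tau x x) * log2 (W x / M).
  have := klein (V := fun x i : B => (x == i)%:R) (s := fun x => W x / M) stau.1 (@onb_delta B).
  under [X in _ -> _ -> _ -> _ <= - X]eq_bigr do rewrite qform_delta.
  apply.
  - by move=> x; rewrite divr_ge0 // ltW.
  - by rewrite stau.2 -mulr_suml divff // gt_eqF.
  move=> x /eqP; rewrite mulf_eq0 invr_eq0 (gt_eqF M0) orbF => /eqP Wx0.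
  by rewrite qform_delta tau0.
have H2 : - \sum_x complex.Re (tau x x) * log2 (W x / M) =
          log2 M - \sum_x complex.Re (tau x x) * log2 (W x).
  rewrite -[log2 M]mul1r -(state_trace_Re stau) mulr_suml -sumrN -sumrB.
  apply: eq_bigr => x _; have [Wx0|Wx] := eqVneq (W x) 0.
    by rewrite tau0 //= !mul0r subr0 oppr0.
  by rewrite /log2 ln_div ?posrE // ?lt_def ?Wx ?W0 //; ring.
have H3 : - \sum_i p i * vN_entropy (chan V (rho i)) <= \sum_x complex.Re (tau x x) * log2 (W x).
  rewrite -sumrN.
  apply: (@le_trans _ _ (\sum_i p i * \sum_x complex.Re (chan V (rho i) x x) * log2 (W x))).
    apply: ler_sum => i _; rewrite -mulrN; apply: ler_wpM2l => //.
    apply: neg_entropy_dominated => //; first exact: (state_chan iV (st i)).1.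
    by move=> v; exact: chan_dominated.
  under eq_bigr do rewrite mulr_sumr.
  rewrite exchange_big /=; apply: ler_sum => x _.
  rewrite /tau chan_avg /avg Re_sum mulr_suml le_eqVlt; apply/orP; left; apply/eqP.
  by apply: eq_bigr => i _; rewrite ReMr mulrA.
rewrite /Holevo -/tau; lra.
Qed.

(** * Tensor powers, with tuples split into first letter and rest *)

Lemma ffun_neqP A n (f g : {ffun 'I_n -> A}) : f != g -> exists i, f i != g i.
Proof.
move=> fg; apply/existsP; apply: contraR fg; rewrite negb_exists => /forallP h.
by apply/eqP/ffunP => i; apply/eqP; have := h i; rewrite negbK.
Qed.

Definition fcons A n (a : A) (f : {ffun 'I_n -> A}) : {ffun 'I_n.+1 -> A} :=
  [ffun i => if unlift ord0 i is Some j then f j else a].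

Lemma fcons0 A n (a : A) (f : {ffun 'I_n -> A}) : fcons a f ord0 = a.
Proof. by rewrite ffunE unlift_none. Qed.

Lemma fconsS A n (a : A) (f : {ffun 'I_n -> A}) i : fcons a f (lift ord0 i) = f i.
Proof. by rewrite ffunE liftK. Qed.

Lemma sum_fcons (M : nmodType) A n (F : {ffun 'I_n.+1 -> A} -> M) :
  \sum_f F f = \sum_a \sum_f F (fcons a f).
Proof.
rewrite pair_big /= (reindex (fun p : A * {ffun 'I_n -> A} => fcons p.1 p.2)) //=.
exists (fun f => (f ord0, [ffun j => f (lift ord0 j)])) => /=.
  by move=> [a f] _ /=; rewrite fcons0; congr (_, _); apply/ffunP => j; rewrite ffunE fconsS.
move=> f _; apply/ffunP => i; rewrite ffunE.
by case: unliftP => [j|] -> //=; rewrite ffunE.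
Qed.

Lemma sum_ffun0 (M : nmodType) A (F : {ffun 'I_0 -> A} -> M) :
  \sum_f F f = F (ffun0 (card_ord 0)).
Proof.
rewrite (bigD1 (ffun0 (card_ord 0))) //= big1 ?addr0 // => f /eqP [].
by apply/ffunP => -[].
Qed.

Lemma tpow_fcons A B E (V : isom R A B E) n b (bs : {ffun 'I_n -> B}) e es a as_ :
  tpow V n.+1 (fcons b bs) (fcons e es) (fcons a as_) = V b e a * tpow V n bs es as_.
Proof.
rewrite /tpow big_ord_recl !fcons0; congr (_ * _).
by apply: eq_bigr => i _; rewrite !fconsS.
Qed.

Definition wpow B (W : B -> R) n (bs : {ffun 'I_n -> B}) : R := \prod_i W (bs i).

Lemma wpow_ge0 B (W : B -> R) n bs : (forall b, 0 <= W b) -> 0 <= wpow W (n := n) bs.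
Proof. by move=> W0; exact: prodr_ge0. Qed.

Lemma wpow1 B n : wpow (fun _ : B => 1) (n := n) = fun=> 1.
Proof. by apply/funext => x; exact: big1. Qed.

Lemma l2norm_fcons B (W : B -> R) n (f : {ffun 'I_n.+1 -> B} -> R) :
  (forall b, 0 <= W b) ->
  l2norm (wpow W (n := n.+1)) f =
  l2norm W (fun b => l2norm (wpow W (n := n)) (fun bs => f (fcons b bs))).
Proof.
move=> W0; rewrite /l2norm sum_fcons; congr Num.sqrt; apply: eq_bigr => b _.
rewrite sqr_l2norm; last by move=> *; exact: wpow_ge0.
rewrite mulr_sumr; apply: eq_bigr => bs _.
rewrite /wpow big_ord_recl fcons0 mulrA; congr (_ * _ * _).
by apply: eq_bigr => i _; rewrite fconsS.
Qed.

(** For fixed first letters the induction hypothesis bounds the inner sum by the partial norms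
    [F b * H e * G a]; multiplying by [|V b e a| >= 0] keeps the inequality, and the single-copy
    bound applied to [F], [H], [G] finishes. For [n = 0] both sides are the product of the values at
    the empty tuple. *)
Lemma trilinear_bound_tpow A B E (V : isom R A B E) (W : B -> R) n :
  (forall b, 0 <= W b) -> trilinear_bound V W -> trilinear_bound (tpow V n) (wpow W (n := n)).
Proof.
move=> W0 bV; elim: n => [|n IH] f h g f0 h0 g0.
  rewrite /l2norm !sum_ffun0 /tpow /wpow !big_ord0 Normc.normc1 !mul1r.
  by rewrite !sqrtr_sqr !ger0_norm.
rewrite (l2norm_fcons _ W0) -(wpow1 E) -(wpow1 A) !l2norm_fcons ?wpow1 //.
pose F b := l2norm (wpow W (n := n)) (fun bs => f (fcons b bs)).
pose H e := l2norm (fun=> 1) (fun es : {ffun 'I_n -> E} => h (fcons e es)).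
pose G a := l2norm (fun=> 1) (fun as_ : {ffun 'I_n -> A} => g (fcons a as_)).
apply: le_trans (bV F H G _ _ _) => *; do ?exact: l2norm_ge0.
rewrite sum_fcons; apply: ler_sum => b _.
under eq_bigr do rewrite sum_fcons.
rewrite exchange_big /=; apply: ler_sum => e _.
under eq_bigr => bs _.
  under eq_bigr do rewrite sum_fcons.
  rewrite exchange_big /=.
over.
rewrite exchange_big /=; apply: ler_sum => a _.
apply: (@le_trans _ _ (Normc.normc (V b e a) * \sum_bs \sum_es \sum_as_
   Normc.normc (tpow V n bs es as_) *
   (f (fcons b bs) * h (fcons e es) * g (fcons a as_)))).
  rewrite le_eqVlt; apply/orP; left; apply/eqP.
  rewrite mulr_sumr; apply: eq_bigr => bs _.
  rewrite mulr_sumr; apply: eq_bigr => es _.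
  rewrite mulr_sumr; apply: eq_bigr => as_ _.
  by rewrite tpow_fcons Normc.normcM -mulrA.
by apply: ler_wpM2l; [exact: normc_ge0 | exact: IH].
Qed.

Lemma isometry_tpow A B E (V : isom R A B E) n : isometry V -> isometry (tpow V n).
Proof.
move=> iV a a'; rewrite /tpow.
transitivity (\prod_(i < n) \sum_b \sum_e conjc (V b e (a i)) * V b e (a' i)).
  rewrite bigA_distr_bigA; apply: eq_bigr => bs _.
  rewrite bigA_distr_bigA; apply: eq_bigr => es _.
  by rewrite rmorph_prod -big_split.
under eq_bigr do rewrite iV.
have [<-|aa'] := eqVneq a a'; first by apply: big1 => i _; rewrite eqxx.
have [i ai] := ffun_neqP aa'.
by rewrite (bigD1 i) //= (negbTE ai) mul0r.
Qed.

Definition tensor I n (T : 'I_n -> op R I) : op R {ffun 'I_n -> I} :=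
  fun f g => \prod_i T i (f i) (g i).

Lemma chan_tpow A B E (V : isom R A B E) n (rho : 'I_n -> op R A) :
  chan (tpow V n) (tensor rho) = tensor (fun i => chan V (rho i)).
Proof.
apply/funext => bs; apply/funext => bs'; rewrite /chan /tensor /tpow.
rewrite bigA_distr_bigA; apply: eq_bigr => es _.
rewrite bigA_distr_bigA; apply: eq_bigr => as1 _.
rewrite bigA_distr_bigA; apply: eq_bigr => as2 _.
by rewrite rmorph_prod -!big_split.
Qed.

(** * Diagonal states, private codes and the capacities they determine *)

Definition diagop I (w : I -> R) : op R I := fun i j => (w i *+ (i == j))%:C.

Lemma diagop_spectral I (w : I -> R) :
  spectral_form (diagop w) (fun x i : I => (x == i)%:R) w.
Proof.
move=> i j; rewrite (bigD1 i) //= big1 ?addr0 => [|k /negbTE ->]; last by rewrite mulr0 mul0r.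
rewrite eqxx mulr1 conjc_nat /diagop.
by case: (i == j) => /=; rewrite ?mulr1n ?mulr0n ?mulr1 ?mulr0.
Qed.

Lemma vN_diagop I (w : I -> R) : vN_entropy (diagop w) = \sum_i - (w i * log2 (w i)).
Proof. exact: vN_spectral (@onb_delta I) (@diagop_spectral I w). Qed.

Lemma trace_diagop I (w : I -> R) : \sum_i diagop w i i = (\sum_i w i)%:C.
Proof. exact: trace_spectral (@onb_delta I) (@diagop_spectral I w). Qed.

Lemma state_diagop I (w : I -> R) : (forall i, 0 <= w i) -> \sum_i w i = 1 ->
  is_state (diagop w).
Proof.
move=> w0 w1; split=> [v|].
  rewrite -/(qform (diagop w) v) (qform_spectral v (@diagop_spectral I w)) ler0c.
  by apply: sumr_ge0 => k _; rewrite mulr_ge0 ?sqnorm_ge0.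
by rewrite trace_diagop w1.
Qed.

Lemma tensor_diagop I n (w : 'I_n -> I -> R) :
  tensor (fun i => diagop (w i)) = diagop (fun f : {ffun 'I_n -> I} => \prod_i w i (f i)).
Proof.
apply/funext => f; apply/funext => g; rewrite /tensor /diagop -rmorph_prod; congr (_%:C).
have [<-|fg] := eqVneq f g; first by apply: eq_bigr => i _; rewrite eqxx.
have [i fi] := ffun_neqP fg.
by rewrite (bigD1 i) //= (negbTE fi) mul0r.
Qed.

(* The messages [s : S] are perfectly distinguishable from the outputs, which
   split the weight [W] along a map [sel], while the environment always sees
   [kap]. *)
Record private_code A B E (V : isom R A B E) S (W : B -> R) (r : S -> A -> R)
    (sel : B -> S) (kap : op R E) : Prop := {
  code_isometry : isometry V;
  code_bound : trilinear_bound V W;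
  code_ge0 : forall b, 0 <= W b;
  code_input_ge0 : forall s a, 0 <= r s a;
  code_input_sum : forall s, \sum_a r s a = 1;
  code_output : forall s, chan V (diagop (r s)) = diagop (fun b => W b *+ (sel b == s));
  code_env : forall s, cchan V (diagop (r s)) = kap
}.

(** The code is used independently on each copy: a product of diagonal inputs is diagonal, and
    outputs and environments factorise letter by letter. *)
Lemma private_code_tpow A B E (V : isom R A B E) S W (r : S -> A -> R) sel kap n :
  private_code V W r sel kap ->
  private_code (tpow V n) (wpow W (n := n))
    (fun (s : {ffun 'I_n -> S}) (a : {ffun 'I_n -> A}) => \prod_i r (s i) (a i))
    (fun b => [ffun i => sel (b i)]) (tensor (fun=> kap)).
Proof.
move=> [iV bV W0 r0 r1 oV eV]; split.
- exact: isometry_tpow.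
- exact: trilinear_bound_tpow.
- by move=> b; exact: wpow_ge0.
- by move=> s a; exact: prodr_ge0.
- by move=> s; rewrite -(bigA_distr_bigA (fun i a => r (s i) a)); apply: big1.
- move=> s; rewrite -(tensor_diagop (fun i => r (s i))) chan_tpow.
  under [X in tensor X]funext do rewrite oV.
  rewrite tensor_diagop; congr diagop; apply/funext => b.
  have [<-|bs] := eqVneq.
    by apply: eq_bigr => i _; rewrite ffunE eqxx.
  have [i bi] := ffun_neqP bs; rewrite ffunE in bi.
  by rewrite (bigD1 i) //= (negbTE bi) mul0r.
- move=> s; rewrite -(tensor_diagop (fun i => r (s i))).
  (* By conversion the complement of the tensor power is the tensor power of the complement. *)
  rewrite -[LHS]/(chan (tpow (swap V) n) _) chan_tpow.
  by congr tensor; apply/funext => i; exact: eV.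
Qed.

(** Contribution of one output letter of weight [w] to the Holevo information of [m] equiprobable
    messages. *)
Lemma log2M_eq (m w : R) : 0 < m -> 0 <= w ->
  - (w / m * log2 (w / m)) - (- (w * log2 w)) / m = w / m * log2 m.
Proof.
move=> m0 w0; have [->|wn] := eqVneq w 0; first by rewrite !mul0r oppr0 mul0r subrr.
by rewrite /log2 ln_div ?posrE // ?lt_def ?wn //; ring.
Qed.

Section Code.
Variables (A B E S : finType) (V : isom R A B E) (W : B -> R) (r : S -> A -> R).
Variables (sel : B -> S) (kap : op R E).
Hypotheses (cV : private_code V W r sel kap) (S_gt0 : (0 < #|S|)%N).

Let card_gt0 : 0 < #|S|%:R :> R. Proof. by rewrite ltr0n. Qed.

(** Each message yields an output of trace one, so each fibre of [sel] carries weight 1. *)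
Lemma code_sum : \sum_b W b = #|S|%:R.
Proof.
rewrite (partition_big sel predT) //= -sum1_card natr_sum; apply: eq_bigr => s _.
have := trace_chan (diagop (r s)) (code_isometry cV).
rewrite (code_output cV) !trace_diagop (code_input_sum cV) => /complexI <-.
by rewrite big_mkcond /=; apply: eq_bigr => b _; case: eqP.
Qed.

Lemma code_ensemble : is_ensemble (fun _ : 'I_#|S| => #|S|%:R^-1)
  (fun i => diagop (r (enum_val i))).
Proof.
split; first by move=> _; rewrite invr_ge0 ltW.
split; first by rewrite sumr_const card_ord -[LHS]mulr_natr mulVf // gt_eqF.
by move=> i; apply: state_diagop; [exact: (code_input_ge0 cV) | exact: (code_input_sum cV)].
Qed.

(** The environment is [kap] for each message and for the average, so its entropies cancel. The
    outputs live on disjoint fibres of [sel], so only the entropy of the uniform choice of message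
    remains. *)
Lemma Ipriv_code : Ipriv V (fun _ : 'I_#|S| => #|S|%:R^-1)
  (fun i => diagop (r (enum_val i))) = log2 #|S|%:R.
Proof.
rewrite /Ipriv /Icoh.
have -> : cchan V (avg (fun _ : 'I_#|S| => #|S|%:R^-1)
    (fun i => diagop (r (enum_val i)))) = kap.
  rewrite cchan_avg; apply/funext => e; apply/funext => e'; rewrite /avg.
  under eq_bigr do rewrite (code_env cV).
  by rewrite -mulr_suml -rmorph_sum code_ensemble.2.1 mul1r.
under [X in _ - X]eq_bigr do rewrite (code_env cV) mulrBr.
rewrite sumrB -mulr_suml code_ensemble.2.1 mul1r.
have -> : chan V (avg (fun _ : 'I_#|S| => #|S|%:R^-1)
    (fun i => diagop (r (enum_val i)))) = diagop (fun b => W b / #|S|%:R).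
  rewrite chan_avg; apply/funext => b; apply/funext => b'; rewrite /avg.
  under eq_bigr do rewrite (code_output cV).
  rewrite -(big_enum_val (A := S) (fun s =>
    (#|S|%:R^-1)%:C * diagop (fun b => W b *+ (sel b == s)) b b')).
  rewrite (bigD1 (sel b)) //= big1 ?addr0.
    rewrite /diagop eqxx -rmorphM; congr (_%:C).
    by case: eqP; rewrite ?mulr1n ?mulr0n ?mulr0 // mulrC.
  by move=> s /negbTE; rewrite eq_sym /diagop => ->; rewrite mulr0n mul0rn mulr0.
have -> : \sum_i #|S|%:R^-1 * vN_entropy (chan V (diagop (r (enum_val (i : 'I_#|S|))))) =
    \sum_b - (W b * log2 (W b)) / #|S|%:R.
  under eq_bigr do rewrite (code_output cV) vN_diagop.
  rewrite -(big_enum_val (A := S) (fun s => #|S|%:R^-1 *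
    \sum_i - (W i *+ (sel i == s) * log2 (W i *+ (sel i == s))))).
  rewrite -mulr_sumr exchange_big mulr_sumr; apply: eq_bigr => b _ /=.
  rewrite (bigD1 (sel b)) //= big1 ?addr0; first by rewrite eqxx mulr1n mulrC.
  by move=> s /negbTE; rewrite eq_sym => ->; rewrite mulr0n mul0r oppr0.
have -> (x y z : R) : x - y - (z - y) = x - z by ring.
rewrite vN_diagop -sumrB.
transitivity (\sum_b W b / #|S|%:R * log2 #|S|%:R).
  by apply: eq_bigr => b _; apply: log2M_eq => //; exact: (code_ge0 cV).
by rewrite -!mulr_suml code_sum divff ?mul1r // gt_eqF.
Qed.

(** The upper bound [log2 (sum W)] and the private rate of the code coincide by [code_sum]; the
    private information lies between them, hence the same value for [P1]. *)
Lemma C1_code : C1 V = (log2 #|S|%:R)%:E.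
Proof.
apply/le_anti/andP; split.
  apply: ub_ereal_sup => _ [m [p [rho [ens ->]]]]; rewrite lee_fin -code_sum.
  apply: Holevo_le => //; [exact: (code_isometry cV) | exact: (code_bound cV) |
    exact: (code_ge0 cV) | by rewrite code_sum].
apply: (@le_trans _ _ (Holevo V (fun _ : 'I_#|S| => #|S|%:R^-1)
  (fun i => diagop (r (enum_val i))))%:E).
  rewrite lee_fin -Ipriv_code Ipriv_le_Holevo //; first exact: (code_isometry cV).
  exact: code_ensemble.
by apply: ereal_sup_ubound; do 3!eexists; split; [exact: code_ensemble|].
Qed.

Lemma P1_code : P1 V = (log2 #|S|%:R)%:E.
Proof.
apply/le_anti/andP; split.
  rewrite -C1_code; apply: ub_ereal_sup => _ [m [p [rho [ens ->]]]].
  apply: (@le_trans _ _ (Holevo V p rho)%:E).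
    by rewrite lee_fin Ipriv_le_Holevo //; exact: (code_isometry cV).
  by apply: ereal_sup_ubound; do 3!eexists; split; [exact: ens|].
rewrite -Ipriv_code.
by apply: ereal_sup_ubound; do 3!eexists; split; [exact: code_ensemble|].
Qed.

End Code.

(** * Cauchy-Schwarz and logarithms of halves *)

Lemma cauchy_schwarz_real I (x y : I -> R) :
  \sum_i x i * y i <= l2norm (fun=> 1) x * l2norm (fun=> 1) y.
Proof.
rewrite /l2norm -sqrtrM; last by apply: sumr_ge0 => i _; rewrite mul1r sqr_ge0.
apply: le_trans (ler_norm _) _; rewrite -sqrtr_sqr; apply: ler_wsqrtr.
rewrite -subr_ge0 -(pmulr_rge0 _ (ltr0n R 2)).
(* Lagrange's identity, doubled so that the sum runs over all ordered pairs. *)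
suff -> : 2%:R * ((\sum_i 1 * x i ^+ 2) * (\sum_i 1 * y i ^+ 2) - (\sum_i x i * y i) ^+ 2) =
    \sum_i \sum_j (x i * y j - x j * y i) ^+ 2.
  by apply: sumr_ge0 => i _; apply: sumr_ge0 => j _; rewrite sqr_ge0.
have -> (a b : R) : 2%:R * (a - b) = a + a - (b + b) by ring.
rewrite {2}[_ * (\sum_i 1 * y i ^+ 2)]mulrC expr2 !big_distrlr /= -!big_split -sumrB /=.
apply: eq_bigr => i _; rewrite -!big_split -sumrB /=.
by apply: eq_bigr => j _; ring.
Qed.

Lemma log2_half : log2 2^-1 = - 1 :> R.
Proof. by rewrite /log2 lnV ?posrE // mulNr divff // gt_eqF // ln2_gt0. Qed.

Lemma log2_div2 (x : R) : 0 < x -> log2 (x / 2) = log2 x - 1.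
Proof.
move=> x0; rewrite /log2 ln_div ?posrE // mulrBl divff // gt_eqF //.
exact: ln2_gt0.
Qed.

Lemma mulr_log2_div2 (x : R) : 0 <= x -> x * log2 (x / 2) = x * log2 x - x.
Proof.
move=> x0; have [->|xn] := eqVneq x 0; first by rewrite !mul0r subr0.
by rewrite log2_div2 ?lt_def ?xn // mulrBr mulr1.
Qed.

(** * The platypus channel carries a one-bit private code *)

Section Platypus.
Variables (d : nat) (mu : 'I_d -> R).
Hypotheses (mu_ge0 : forall j, 0 <= mu j) (mu_sum : \sum_j mu j = 1).
Let V : isom R 'I_d.+1 'I_d.+1 'I_d := platypus mu.

(** Indexing used throughout: [lift ord0 i] is the input [|i+1>], [lift ord_max j] is the output
    [|j>] with [j < d], and [ord_max] is the output [|d>]. *)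
Lemma platypus_00 (e : 'I_d) (j : 'I_d) :
  V (lift ord_max j) e ord0 = (Num.sqrt (mu e) *+ (j == e))%:C.
Proof. by rewrite /V /platypus lift_max /= -[in RHS]val_eqE /=; case: eqP. Qed.

Lemma platypus_d0 (e : 'I_d) : V ord_max e ord0 = 0.
Proof. by rewrite /V /platypus /= gtn_eqF. Qed.

Lemma platypus_0S (e i j : 'I_d) : V (lift ord_max j) e (lift ord0 i) = 0.
Proof. by rewrite /V /platypus lift_max /= ltn_eqF. Qed.

Lemma platypus_dS (e i : 'I_d) : V ord_max e (lift ord0 i) = (e == i)%:R.
Proof. by rewrite /V /platypus /= eqxx /bump /= add1n eqSS val_eqE; case: eqP. Qed.

Lemma sum_ord_max (M : nmodType) (F : 'I_d.+1 -> M) :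
  \sum_b F b = \sum_(j < d) F (lift ord_max j) + F ord_max.
Proof.
rewrite big_ord_recr; congr (_ + _); apply: eq_bigr => j _; congr F.
by apply: ord_inj; rewrite lift_max.
Qed.

Lemma lift_neq_max (j : 'I_d) : (lift ord_max j == ord_max) = false.
Proof. by rewrite eq_sym (negbTE (neq_lift _ _)). Qed.

Definition weight (b : 'I_d.+1) : R := if unlift ord_max b is Some j then mu j else 1.

Lemma weight_lift j : weight (lift ord_max j) = mu j.
Proof. by rewrite /weight liftK. Qed.

Lemma weight_max : weight ord_max = 1.
Proof. by rewrite /weight unlift_none. Qed.

(** [false] is the input [|0><0|], whose output is [diag(mu)] on the levels below [|d>]; [true] is
    [diag(0, mu)], whose output is [|d><d|]. *)
Definition message (s : bool) (a : 'I_d.+1) : R :=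
  if unlift ord0 a is Some j then mu j *+ s else (~~ s)%:R.

Lemma message_lift s j : message s (lift ord0 j) = mu j *+ s.
Proof. by rewrite /message liftK. Qed.

Lemma message_0 s : message s ord0 = (~~ s)%:R.
Proof. by rewrite /message unlift_none. Qed.

Lemma weight_ge0 b : 0 <= weight b.
Proof. by rewrite /weight; case: unlift => //= j. Qed.

Lemma isometry_platypus : isometry V.
Proof.
move=> a a'; rewrite sum_ord_max.
case: (unliftP ord0 a) => [i|] ->; case: (unliftP ord0 a') => [i'|] ->.
- rewrite big1 => [|j _]; last by apply: big1 => e _; rewrite platypus_0S conjc0 mul0r.
  rewrite add0r (bigD1 i) //= !platypus_dS eqxx conjc1 mul1r big1 ?addr0.
    by rewrite (inj_eq lift_inj).
  by move=> e /negbTE ei; rewrite platypus_dS ei conjc0 mul0r.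
- rewrite big1 => [|j _]; last by apply: big1 => e _; rewrite platypus_0S conjc0 mul0r.
  by rewrite add0r big1 // => e _; rewrite platypus_d0 mulr0.
- rewrite big1 => [|j _]; last by apply: big1 => e _; rewrite platypus_0S mulr0.
  by rewrite add0r big1 // => e _; rewrite platypus_d0 conjc0 mul0r.
rewrite [X in _ + X]big1 => [|e _]; last by rewrite platypus_d0 mulr0.
rewrite addr0 eqxx mulr1n -[RHS](rmorph1 (real_complex R)) -mu_sum rmorph_sum /=.
apply: eq_bigr => j _; rewrite (bigD1 j) //= big1 ?addr0.
  by rewrite platypus_00 eqxx mulr1n conjc_real -rmorphM /= -expr2 sqr_sqrtr.
by move=> e /negbTE; rewrite platypus_00 eq_sym => ->; rewrite mulr0.
Qed.

Lemma normc_real (x : R) : 0 <= x -> Normc.normc x%:C = x.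
Proof. by move=> x0; rewrite /= expr0n addr0 sqrtr_sqr ger0_norm. Qed.

(** The form splits into [g_0 <f1, h> + f_d <g1, h>]. Cauchy-Schwarz removes [h] from both terms,
    then applies again in dimension 2 to the pairs [(al, fd)] and [(g_0, be)]. *)
Lemma trilinear_bound_platypus : trilinear_bound V weight.
Proof.
move=> f h g f0 h0 g0.
(* Absorbing the entry [sqrt (mu j)] into [f] makes the squared norm of [f1] the part of the
   weighted norm below [|d>]. *)
pose f1 j := Num.sqrt (mu j) * f (lift ord_max j); pose fd := f ord_max.
pose g1 j := g (lift ord0 j).
have -> : \sum_b \sum_e \sum_a Normc.normc (V b e a) * (f b * h e * g a) =
   g ord0 * (\sum_j f1 j * h j) + fd * (\sum_j g1 j * h j).
  rewrite sum_ord_max !mulr_sumr; congr (_ + _).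
    apply: eq_bigr => j _; rewrite (bigD1 j) //= [X in _ + X]big1 ?addr0.
      rewrite big_ord_recl big1 ?addr0 => [|i _]; last by rewrite platypus_0S Normc.normc0 mul0r.
      by rewrite platypus_00 eqxx mulr1n normc_real ?sqrtr_ge0 // /f1; ring.
    move=> e /negbTE; rewrite eq_sym => je.
    rewrite big_ord_recl big1 ?addr0 => [|i _]; last by rewrite platypus_0S Normc.normc0 mul0r.
    by rewrite platypus_00 je mulr0n Normc.normc0 mul0r.
  apply: eq_bigr => e _; rewrite big_ord_recl platypus_d0 Normc.normc0 mul0r add0r.
  rewrite (bigD1 e) //= platypus_dS eqxx Normc.normc1 big1 ?addr0 => [|i /negbTE].
    by rewrite /fd /g1; ring.
  by rewrite eq_sym platypus_dS => ->; rewrite Normc.normc0 mul0r.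
set al := l2norm (fun=> 1) f1; set be := l2norm (fun=> 1) g1; set H := l2norm _ h.
have al0 : 0 <= al := l2norm_ge0 _ _; have be0 : 0 <= be := l2norm_ge0 _ _.
have H0 : 0 <= H := l2norm_ge0 _ _.
have -> : l2norm weight f = Num.sqrt (al ^+ 2 + fd ^+ 2).
  rewrite sqr_l2norm // /l2norm sum_ord_max weight_max mul1r; congr (Num.sqrt (_ + _)).
  by apply: eq_bigr => j _; rewrite weight_lift /f1 exprMn sqr_sqrtr // mul1r.
have -> : l2norm (fun=> 1) g = Num.sqrt (g ord0 ^+ 2 + be ^+ 2).
  by rewrite sqr_l2norm // /l2norm big_ord_recl mul1r.
apply: (@le_trans _ _ (H * (al * g ord0 + fd * be))).
  have -> : H * (al * g ord0 + fd * be) = g ord0 * (al * H) + fd * (be * H) by ring.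
  by apply: lerD; apply: ler_wpM2l; rewrite ?f0 ?g0 //; exact: cauchy_schwarz_real.
have -> (x y : R) : x * H * y = H * (x * y) by ring.
apply: ler_wpM2l => //; rewrite -sqrtrM ?addr_ge0 ?sqr_ge0 //.
apply: le_trans (ler_norm _) _; rewrite -sqrtr_sqr; apply: ler_wsqrtr.
rewrite -subr_ge0.
suff -> : (al ^+ 2 + fd ^+ 2) * (g ord0 ^+ 2 + be ^+ 2) - (al * g ord0 + fd * be) ^+ 2 =
  (al * be - fd * g ord0) ^+ 2 by rewrite sqr_ge0.
by ring.
Qed.

Lemma chan_diagop A B E (U : isom R A B E) (w : A -> R) b b' :
  chan U (diagop w) b b' = \sum_e \sum_a (w a)%:C * (U b e a * conjc (U b' e a)).
Proof.
apply: eq_bigr => e _; apply: eq_bigr => a _.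
rewrite (bigD1 a) //= big1 ?addr0 => [|a' /negbTE]; first by rewrite /diagop eqxx mulr1n; ring.
by rewrite eq_sym /diagop => ->; rewrite mulr0n mulr0 mul0r.
Qed.

Lemma chan_message s :
  chan V (diagop (message s)) = diagop (fun b => weight b *+ ((b == ord_max) == s)).
Proof.
apply/funext => b; apply/funext => b'; rewrite chan_diagop.
under eq_bigr do rewrite big_ord_recl message_0.
rewrite big_split /=.
case: (unliftP ord_max b) => [j|] ->; case: (unliftP ord_max b') => [j'|] ->.
- rewrite [X in _ + X]big1 ?addr0 => [|e _]; last first.
    by apply: big1 => i _; rewrite platypus_0S mul0r mulr0.
  rewrite (bigD1 j) //= big1 ?addr0 => [|e /negbTE]; last first.
    by rewrite eq_sym platypus_00 => ->; rewrite mul0r mulr0.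
  rewrite !platypus_00 eqxx mulr1n conjc_real -!rmorphM /diagop (inj_eq lift_inj).
  rewrite weight_lift lift_neq_max /=; congr (_%:C).
  have [_|_] := eqVneq j' j; last by rewrite !mulr0n !mulr0.
  by rewrite !mulr1n -expr2 sqr_sqrtr //; case: (s); rewrite ?mul0r ?mul1r.
- rewrite [X in _ + X]big1 ?addr0 => [|e _]; last first.
    by apply: big1 => i _; rewrite platypus_0S mul0r mulr0.
  rewrite big1 => [|e _]; last by rewrite platypus_d0 conjc0 !mulr0.
  by rewrite /diagop lift_neq_max.
- rewrite [X in _ + X]big1 ?addr0 => [|e _]; last first.
    by apply: big1 => i _; rewrite platypus_0S conjc0 !mulr0.
  rewrite big1 => [|e _]; last by rewrite platypus_d0 mul0r mulr0.
  by rewrite /diagop (negbTE (neq_lift _ _)).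
rewrite big1 ?add0r => [|e _]; last by rewrite platypus_d0 mul0r mulr0.
rewrite /diagop !eqxx weight_max mulr1n.
under eq_bigr => e _.
  rewrite (bigD1 e) //= platypus_dS eqxx conjc1 mulr1 mulr1 message_lift.
  rewrite big1 ?addr0 => [|i /negbTE]; last first.
    by rewrite eq_sym platypus_dS => ->; rewrite mul0r mulr0.
over.
by rewrite -rmorph_sum sumrMnl mu_sum; case: (s).
Qed.

(** Privacy: the entangled vector [V|0>] leaves [diag mu] in the environment, and [V|i> = |d>|i-1>]
    moves [diag(0, mu)] onto the same operator. *)
Lemma cchan_message s : cchan V (diagop (message s)) = diagop mu.
Proof.
apply/funext => e; apply/funext => e'.
rewrite -[LHS]/(chan (swap V) _ e e') chan_diagop /swap.
under eq_bigr do rewrite big_ord_recl message_0.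
rewrite big_split /= !sum_ord_max.
rewrite [X in _ + (X + _)]big1 ?add0r => [|j _]; last first.
  by apply: big1 => i _; rewrite platypus_0S mul0r mulr0.
rewrite platypus_d0 mul0r mulr0 addr0 /diagop.
rewrite (bigD1 e) //= [X in _ + X + _]big1 ?addr0 => [|j /negbTE]; last first.
  by rewrite platypus_00 => ->; rewrite mul0r mulr0.
rewrite (bigD1 e) //= [X in _ + (_ + X)]big1 ?addr0 => [|j /negbTE]; last first.
  by rewrite eq_sym platypus_dS => ->; rewrite mul0r mulr0.
rewrite !platypus_00 !platypus_dS eqxx message_lift eq_sym mulr1n conjc_nat mul1r.
rewrite conjc_real; have [->|_] := eqVneq e' e; last first.
  by rewrite !mulr0n !mulr0 addr0.
rewrite !mulr1n mulr1 -!rmorphM -rmorphD -expr2 sqr_sqrtr //; congr (_%:C).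
by case: (s); rewrite ?mul0r ?add0r ?mul1r ?addr0.
Qed.

Lemma private_code_platypus :
  private_code V weight message (fun b => b == ord_max) (diagop mu).
Proof.
split; [exact: isometry_platypus | exact: trilinear_bound_platypus |
  exact: weight_ge0 | | | exact: chan_message | exact: cchan_message].
  by move=> s a; rewrite /message; case: unlift => [j|]; rewrite ?mulrn_wge0 ?ler0n.
move=> s; rewrite big_ord_recl message_0.
under eq_bigr do rewrite message_lift.
by rewrite sumrMnl mu_sum; case: s; rewrite ?add0r ?addr0.
Qed.

(** * Entanglement-assisted capacity *)

(* Klein's inequality for [N(rho)] on the computational basis with weights
   [weight / 2], and for [rho] on [|0>] together with the shifted eigenvectors of
   [N^c(rho) = p diag(mu) + rho'], with weights [1/2] and [kappa_x / 2]. *)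
Lemma CE_platypus_le (rho : op R 'I_d.+1) : is_state rho ->
  vN_entropy rho + Icoh V rho <= 2.
Proof.
move=> srho; have srho1 := srho.1 : psd rho.
set p := complex.Re (rho ord0 ord0).
have p0 : 0 <= p.
  by have := srho1 (fun i => (ord0 == i)%:R); rewrite qform_delta lecE => /andP[].
pose rho' : op R 'I_d := fun i j => rho (lift ord0 i) (lift ord0 j).
have rho00 : rho ord0 ord0 = p%:C.
  have := srho1 (fun i => (ord0 == i)%:R); rewrite qform_delta => h.
  by rewrite -[LHS](RRe_real (ger0_real h)).
(* [ext] shifts an environment vector onto [|1>, ..., |d>], where [rho] restricts to [rho']. *)
pose ext (v : 'I_d -> C) (a : 'I_d.+1) : C := if unlift ord0 a is Some j then v j else 0.
have ext0 v : ext v ord0 = 0 by rewrite /ext unlift_none.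
have extS v j : ext v (lift ord0 j) = v j by rewrite /ext liftK.
have qext v : qform rho (ext v) = qform rho' v.
  rewrite /qform big_ord_recl ext0 big1 ?add0r => [|j _]; last by rewrite conjc0 !mul0r.
  apply: eq_bigr => i _; rewrite big_ord_recl ext0 mulr0 add0r.
  by apply: eq_bigr => j _; rewrite !extS.
have skap := state_cchan isometry_platypus srho; set kap := cchan V rho in skap.
have kapE e e' : kap e e' = p%:C * diagop mu e e' + rho' e e'.
  rewrite /kap /cchan sum_ord_max; congr (_ + _); last first.
    rewrite big_ord_recl big1 ?add0r => [|a' _]; last by rewrite platypus_d0 !mul0r.
    rewrite (bigD1 e) //= [X in _ + X]big1 ?addr0 => [|i /negbTE ei]; last first.
      by apply: big1 => a' _; rewrite platypus_dS eq_sym ei !mul0r.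
    rewrite big_ord_recl platypus_d0 conjc0 mulr0 add0r.
    rewrite (bigD1 e') //= big1 ?addr0 => [|i /negbTE ei]; last first.
      by rewrite !platypus_dS [e' == i]eq_sym ei conjc0 mulr0.
    by rewrite !platypus_dS !eqxx conjc1 mul1r mulr1.
  rewrite (bigD1 e) //= [X in _ + X]big1 ?addr0 => [|j /negbTE je]; last first.
    apply: big1 => a _; apply: big1 => a' _.
    case: (unliftP ord0 a) => [i|] ->; first by rewrite platypus_0S !mul0r.
    by rewrite platypus_00 je mulr0n !mul0r.
  rewrite big_ord_recl [X in _ + X]big1 ?addr0 => [|i _]; last first.
    by apply: big1 => a' _; rewrite platypus_0S !mul0r.
  rewrite big_ord_recl [X in _ + X]big1 ?addr0 => [|i _]; last first.
    by rewrite platypus_0S conjc0 mulr0.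
  rewrite !platypus_00 eqxx mulr1n rho00 conjc_real /diagop.
  have [->|_] := eqVneq e e'; last by rewrite !mulr0n !mulr0.
  by rewrite !mulr1n -!rmorphM; congr (_%:C); rewrite /= mulrC mulrA -expr2 sqr_sqrtr // mulrC.
have [v [k [ov fk k0]]] := psd_spectralP (skap.1 : psd kap).
have k1 : \sum_x k x = 1 by apply: complexI; rewrite -(trace_spectral ov fk) skap.2.
pose m x := complex.Re (qform (diagop mu) (v x)); pose t x := complex.Re (qform rho' (v x)).
have sdmu : is_state (diagop mu) by exact: state_diagop.
have m0 x : 0 <= m x by have := sdmu.1 (v x); rewrite lecE => /andP[].
have t0 x : 0 <= t x by have := srho1 (ext (v x)); rewrite qext lecE => /andP[].
have kE x : k x = p * m x + t x.
  have := qform_spectral_eigen x ov fk => /(congr1 (@complex.Re R)) /= <-.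
  rewrite /m /t -ReMr -raddfD /=; congr complex.Re.
  rewrite /qform mulr_sumr -big_split; apply: eq_bigr => i _ /=.
  rewrite mulr_sumr -big_split; apply: eq_bigr => j _ /=.
  by rewrite kapE; ring.
have kz x : k x = 0 -> p * m x = 0 /\ t x = 0.
  rewrite kE => /eqP; rewrite paddr_eq0 ?mulr_ge0 // => /andP[/eqP -> /eqP ->] //.
(* Klein for [diag mu] in the eigenbasis of [kap], with its eigenvalues as weights. For [p <> 0] the
   support condition holds because [k x = p * m x + t x] has nonnegative terms. *)
have Hmu : p * vN_entropy (diagop mu) <= - (p * \sum_x m x * log2 (k x)).
  have [->|pn0] := eqVneq p 0; first by rewrite !mul0r oppr0.
  rewrite -mulrN; apply: ler_wpM2l => //; apply: klein => //; first exact: sdmu.1.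
    by rewrite k1 sdmu.2.
  move=> x /kz [/eqP]; rewrite mulf_eq0 (negbTE pn0) /= => /eqP mx _.
  have := sdmu.1 (v x); rewrite -/(qform _ _) => h.
  by rewrite -(RRe_real (ger0_real h)) -/(m x) mx.
have Hrho : vN_entropy rho <= 1 - \sum_x t x * log2 (k x).
  pose U (a : 'I_d.+1) : 'I_d.+1 -> C :=
    if unlift ord0 a is Some x then ext (v x) else fun i => (ord0 == i)%:R.
  have U0 : U ord0 = fun i => (ord0 == i)%:R by rewrite /U unlift_none.
  have US x : U (lift ord0 x) = ext (v x) by rewrite /U liftK.
  have dot_ext x y : dot (ext (v x)) (ext (v y)) = (x == y)%:R.
    rewrite /dot big_ord_recl !ext0 mulr0 add0r -ov.
    by apply: eq_bigr => j _; rewrite !extS.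
  have oU : onb U.
    move=> a b; case: (unliftP ord0 a) => [x|] ->; case: (unliftP ord0 b) => [y|] ->.
    - by rewrite !US dot_ext (inj_eq lift_inj).
    - by rewrite US U0 dot_delta ext0 conjc0 eq_sym (negbTE (neq_lift _ _)).
    - by rewrite US U0 -dot_conj dot_delta ext0 conjc0 conjc0 (negbTE (neq_lift _ _)).
    by rewrite U0 dot_delta eqxx conjc1.
  pose s (a : 'I_d.+1) : R := if unlift ord0 a is Some x then k x / 2 else 2^-1.
  have s_0 : s ord0 = 2^-1 by rewrite /s unlift_none.
  have sS x : s (lift ord0 x) = k x / 2 by rewrite /s liftK.
  have K : vN_entropy rho <= - \sum_a complex.Re (qform rho (U a)) * log2 (s a).
    apply: klein => //.
    - by move=> a; rewrite /s; case: unlift => [x|]; rewrite ?divr_ge0 ?invr_ge0 ?ler0n.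
    - rewrite big_ord_recl s_0; under eq_bigr do rewrite sS.
      by rewrite -mulr_suml k1 srho.2 (_ : 2^-1 + 1 / 2 = 1 :> R) //; field.
    move=> a; case: (unliftP ord0 a) => [x|] ->; last first.
      by rewrite s_0 => /eqP; rewrite invr_eq0 pnatr_eq0.
    rewrite sS => /eqP; rewrite mulf_eq0 invr_eq0 pnatr_eq0 orbF => /eqP /kz [_ tx].
    have := srho1 (U (lift ord0 x)); rewrite US qext => h.
    by rewrite -(RRe_real (ger0_real h)) -/(t x) tx.
  (* The factors 1/2 in the weights contribute [p] from [|0>] and [1 - p] from the rest, which is
     the constant 1 in [Hrho]. *)
  have tr : \sum_x t x = 1 - p.
    have m1 : \sum_x m x = 1 by rewrite -Re_sum (trace_onb _ ov) sdmu.2.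
    move: k1; under eq_bigr do rewrite kE.
    by rewrite big_split /= -mulr_sumr m1; lra.
  apply: le_trans K _; rewrite big_ord_recl s_0 U0 qform_delta rho00 /= log2_half.
  have -> : \sum_(x < d) complex.Re (qform rho (U (lift ord0 x))) * log2 (s (lift ord0 x)) =
      \sum_x t x * log2 (k x) - (1 - p).
    rewrite -tr -sumrB; apply: eq_bigr => x _; rewrite US qext sS -/(t x).
    have [kx|kx] := eqVneq (k x) 0; first by rewrite (kz x kx).2 !mul0r subr0.
    by rewrite log2_div2 ?lt_def ?kx ?k0 // mulrBr mulr1.
  lra.
(* The diagonal of the output is [p * mu j] at [|j>] and [1 - p] at [|d>]; against [weight / 2] the
   halves again contribute 1. *)
have HN : vN_entropy (chan V rho) <= 1 + p * vN_entropy (diagop mu).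
  have sN := state_chan isometry_platypus srho.
  have chan00 j : chan V rho (lift ord_max j) (lift ord_max j) = (p * mu j)%:C.
    rewrite /chan (bigD1 j) //= [X in _ + X]big1 ?addr0 => [|e /negbTE]; last first.
      rewrite eq_sym => je; apply: big1 => a _; apply: big1 => a' _.
      case: (unliftP ord0 a) => [i|] ->; first by rewrite platypus_0S !mul0r.
      by rewrite platypus_00 je mulr0n !mul0r.
    rewrite big_ord_recl [X in _ + X]big1 ?addr0 => [|i _]; last first.
      by apply: big1 => a' _; rewrite platypus_0S !mul0r.
    rewrite big_ord_recl [X in _ + X]big1 ?addr0 => [|i _]; last first.
      by rewrite platypus_0S conjc0 mulr0.
    rewrite platypus_00 eqxx mulr1n rho00 conjc_real -!rmorphM /=.
    by congr (_%:C); rewrite mulrC mulrA -expr2 sqr_sqrtr // mulrC.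
  have chandd : complex.Re (chan V rho ord_max ord_max) = 1 - p.
    have := state_trace_Re sN; rewrite sum_ord_max.
    under eq_bigr do rewrite chan00 /=.
    by rewrite -mulr_sumr mu_sum; lra.
  have K : vN_entropy (chan V rho) <=
      - \sum_b complex.Re (qform (chan V rho) (fun i => (b == i)%:R)) * log2 (weight b / 2).
    apply: (klein (V := fun b i : 'I_d.+1 => (b == i)%:R) (s := fun b => weight b / 2)).
    - exact: sN.1.
    - exact: onb_delta.
    - by move=> b; rewrite divr_ge0 ?weight_ge0.
    - rewrite sN.2 sum_ord_max weight_max; under eq_bigr do rewrite weight_lift.
      by rewrite -mulr_suml mu_sum (_ : 1 / 2 + 1 / 2 = 1 :> R) //; field.
    move=> b /eqP; rewrite mulf_eq0 invr_eq0 pnatr_eq0 orbF qform_delta => /eqP.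
    case: (unliftP ord_max b) => [j|] ->.
      by rewrite weight_lift chan00 => ->; rewrite mulr0.
    by rewrite weight_max => /eqP; rewrite oner_eq0.
  apply: le_trans K _; rewrite sum_ord_max qform_delta chandd weight_max mul1r log2_half.
  have -> : \sum_(j < d) complex.Re (qform (chan V rho) (fun i => (lift ord_max j == i)%:R)) *
      log2 (weight (lift ord_max j) / 2) = - (p * vN_entropy (diagop mu)) - p.
    transitivity (- (p * vN_entropy (diagop mu)) - p * \sum_j mu j); last by rewrite mu_sum mulr1.
    rewrite vN_diagop !mulr_sumr -sumrN -sumrB.
    apply: eq_bigr => j _; rewrite qform_delta chan00 weight_lift /= -mulrA mulr_log2_div2 //.
    by ring.
  lra.
(* In the total, the [t] terms cancel those of [Hrho], and [Hmu] lets the [m] terms absorb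
   [p * S(diag mu)] from [HN], leaving 1 + 1. *)
have Hk : vN_entropy kap = - \sum_x (p * m x + t x) * log2 (k x).
  rewrite (vN_spectral ov fk) -sumrN; apply: eq_bigr => x _.
  by rewrite [X in X * log2 _]kE.
move: Hk; under eq_bigr do rewrite mulrDl -mulrA.
rewrite big_split /= -mulr_sumr /Icoh -/kap => ->.
move: Hmu Hrho HN.
move: (vN_entropy rho) (vN_entropy (chan V rho)) (p * vN_entropy _) (p * \sum_x _).
by move: (\sum_x t x * _) => x1 x2 x3 x4 x5; clear; lra.
Qed.

(** The optimum is the uniform mixture of the two code inputs, [diag(1/2, mu/2)]: input and output
    both have entropy [1 + H(mu)/2], the environment has [H(mu)]. *)
Lemma CE_platypus_attained : exists2 rho : op R 'I_d.+1, is_state rho &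
  vN_entropy rho + Icoh V rho = 2.
Proof.
pose q a := (message false a + message true a) / 2.
pose r (i : 'I_2) := diagop (message (i != ord0)).
pose p (i : 'I_2) : R := 2^-1.
have cV := private_code_platypus.
have ens : is_ensemble p r.
  split; first by move=> i; rewrite invr_ge0.
  split; first by rewrite !big_ord_recl big_ord0 /p; field.
  by move=> i; apply: state_diagop; [exact: (code_input_ge0 cV) | exact: (code_input_sum cV)].
have rq : avg p r = diagop q.
  apply/funext => a; apply/funext => a'; rewrite /avg !big_ord_recl big_ord0 addr0.
  rewrite /r /= -!rmorphM -rmorphD; congr (_%:C); rewrite /= /p /q.
  by case: (a == a'); rewrite ?mulr1n ?mulr0n; field.
exists (avg p r); first exact: state_avg.
have q0 : q ord0 = 2^-1 by rewrite /q !message_0 addr0 mul1r.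
have qS j : q (lift ord0 j) = mu j / 2 by rewrite /q !message_lift add0r.
have cr : chan V (avg p r) = diagop (fun b => weight b / 2).
  rewrite chan_avg; apply/funext => b; apply/funext => b'.
  rewrite /avg !big_ord_recl big_ord0 addr0 /r !chan_message.
  rewrite /= -!rmorphM -rmorphD; congr (_%:C); rewrite /= /p.
  by case: (b == ord_max) (b == b') => -[]; rewrite ?mulr1n ?mulr0n; field.
have cc : cchan V (avg p r) = diagop mu.
  rewrite cchan_avg; apply/funext => e; apply/funext => e'; rewrite /avg.
  under eq_bigr do rewrite /r cchan_message.
  by rewrite -mulr_suml -rmorph_sum ens.2.1 mul1r.
rewrite /Icoh cr cc rq !vN_diagop big_ord_recl q0 sum_ord_max weight_max mul1r log2_half.
have e1 : \sum_(j < d) - (mu j / 2 * log2 (mu j / 2)) =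
    (\sum_j - (mu j * log2 (mu j)) + 1) / 2.
  transitivity ((\sum_j - (mu j * log2 (mu j)) + \sum_j mu j) / 2); last by rewrite mu_sum.
  rewrite -big_split mulr_suml; apply: eq_bigr => j _ /=.
  by rewrite mulrAC mulr_log2_div2 //; field.
under eq_bigr do rewrite qS.
under [X in _ + (X + _ - _)]eq_bigr do rewrite weight_lift.
by rewrite e1; field.
Qed.

End Platypus.

(** * Assembly of the five capacities *)

Lemma log2_expn n : log2 (2 ^+ n) = n%:R :> R.
Proof. by rewrite /log2 lnXn // -[ln 2 *+ n]mulr_natl mulfK // gt_eqF // ln2_gt0. Qed.

End OneParameter.

Theorem theorem2 (R : realType) (d : nat) (mu : 'I_d -> R) :
  (0 < d)%N -> (forall j, 0 <= mu j)%R -> (\sum_j mu j = 1)%R ->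
  P1 (platypus mu) = 1%:E /\
  C1 (platypus mu) = 1%:E /\
  (fun n : nat => (n.+1%:R^-1)%:E * P1 (tpow (platypus mu) n.+1)) @ \oo --> 1%:E /\
  (fun n : nat => (n.+1%:R^-1)%:E * C1 (tpow (platypus mu) n.+1)) @ \oo --> 1%:E /\
  CE (platypus mu) = 2%:E.
Proof.
move=> _ mu0 mu1; have cV := private_code_platypus mu0 mu1.
have b_gt0 : (0 < #|{: bool}|)%N by rewrite card_bool.
have b_log : log2 #|{: bool}|%:R = 1%R :> R by rewrite card_bool -[2%:R]expr1 log2_expn.
have f_gt0 n : (0 < #|{ffun 'I_n -> bool}|)%N.
  by rewrite card_ffun card_bool expn_gt0.
have f_log n : log2 #|{ffun 'I_n -> bool}|%:R = n%:R :> R.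
  by rewrite card_ffun card_bool card_ord natrX log2_expn.
have rate n : (n.+1%:R^-1)%:E * (n.+1%:R)%:E = 1%:E :> \bar R.
  by rewrite -EFinM mulVf // pnatr_eq0.
split; first by rewrite (P1_code cV) ?b_log.
split; first by rewrite (C1_code cV) ?b_log.
split.
  (* The product code has [2 ^ n.+1] messages, so each normalised term equals 1 and the sequence is
     constant. *)
  rewrite (_ : (fun n : nat => _) = fun=> 1%:E); first exact: cvg_cst.
  by apply/funext => n; rewrite (P1_code (private_code_tpow n.+1 cV)) // f_log rate.
split.
  rewrite (_ : (fun n : nat => _) = fun=> 1%:E); first exact: cvg_cst.
  by apply/funext => n; rewrite (C1_code (private_code_tpow n.+1 cV)) // f_log rate.
apply/le_anti/andP; split.
  by apply: ub_ereal_sup => _ [rho [srho ->]]; rewrite lee_fin CE_platypus_le.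
have [rho srho <-] := CE_platypus_attained mu0 mu1.
by apply: ereal_sup_ubound; exists rho.
Qed.
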